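(* Let $n\ge 10$ and $I\in\mathcal{I}_n$. Then the complex $\Delta(I)$ is a centrally symmetric combinatorial $3$-sphere on the vertex set $V_{n+1}$ that is cs-$2$-neighborly with respect to $V_{n+1}$.
   Context: Simplicial complexes are finite abstract simplicial complexes; $\overline{A}$ is the simplex of all subsets of a finite set $A$. $V_m=\{\pm1,\dots,\pm m\}$; $-\sigma=\{-v:v\in\sigma\}$, $-\Gamma=\{-\sigma:\sigma\in\Gamma\}$. The join is $\Gamma*\Gamma'=\{\sigma\cup\tau\}$, $\Gamma*v:=\Gamma*\overline{\{v\}}$; a path/cycle $(v_1,\dots,v_m)$ is the 1-dimensional complex with edges $\{v_j,v_{j+1}\}$. $\partial C^*_m$ is the complex of all subsets of $V_m$ with no pair $\{j,-j\}$. For pure $\Delta$ and pure full-dimensional subcomplex $\Gamma$, $\Delta\setminus\Gamma$ is generated by facets of $\Delta$ not in $\Gamma$; $\partial B$ is the boundary of a combinatorial ball $B$. Recursive definition: $\Delta^1_n=(1,\dots,n,-1,\dots,-n,1)$; $\Delta^d_{d+1}=\partial C^*_{d+1}$; $B^{d,j}_n=\emptyset$ for $j<0$; $B^{1,0}_n=\overline{\{-1,n\}}$; $B^{2k-1,k}_n=\Delta^{2k-1}_n\setminus B^{2k-1,k-1}_n$ ($k\ge1$, $n\ge 2k$); $B^{d,i}_n=(B^{d-1,i}_{n-1}*n)\cup((-B^{d-1,i-1}_{n-1})*(-n))$ ($d\ge2$, $n\ge d+1$, $i\le\lfloor d/2\rfloor$); $\Delta^d_{n+1}$ is obtained from $\Delta^d_n$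 by replacing $B=B^{d,\lceil d/2\rceil-1}_n$ with $\partial B*(n+1)$ and $-B$ with $\partial(-B)*(-n-1)$ (known to be well defined; $\Delta^3_n$ is a combinatorial 3-sphere on $V_n$). Let $\mathcal{I}_n$ be the collection of all sets $I=\{i_1<\dots<i_p\}\subseteq\{3,4,\dots,n-6\}$ ($p\ge0$) such that $i_2-i_1>1$ if $p\ge2$; set $i_{p+1}:=n-2$. Let $B(I)$ be the pure 3-dimensional complex whose facets are: $\{1,2,i,i+2\}$ for $3\le i\le n-2$; $\{1,2,n-1,n\}$; $\{1,-n+2,n-1,n\}$, $\{1,-n+2,-n+1,n\}$, $\{1,-n+2,-n+1,-n\}$; $\{-n+m+1,-n+m,n-1,n\}$ for $2\le m\le i_1$ (if $p=0$, for $2\le m\le n-2$); and for each $1\le j\le p$: $\{1,-n+i_j+2,n-i_j-1,n-i_j+1\}$ and $\{-n+m+1,-n+m,n-i_j-1,n-i_j+1\}$ for $i_j+2\le m\le i_{j+1}$. Let $\partial B(I)$ denote the complex generated by the 2-faces of $B(I)$ contained in exactly one facet of $B(I)$. Define $\Delta(I)$ as the complex obtained from $\Delta^3_n$ by replacing $B(I)$ with $\partial B(I)*(n+1)$ and $-B(I)$ with $\partial(-B(I))*(-n-1)$, i.e. its facets are the facets of $\Delta^3_n$ not in $B(I)\cup -B(I)$, together with $\tau\cup\{n+1\}$ and $-\tau\cup\{-n-1\}$ for facets $\tau$ of $\partial B(I)$. A complex is centrally symmetric if it is closed under $\sigma\mapsto -\sigma$; it is cs-$i$-neighborly w.r.t.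 $V_m$ if every subset of $V_m$ of size $\le i$ with no pair $\{v,-v\}$ is a face. *)

(* Defs.v *)
From HB Require Import structures.
From mathcomp Require Import all_boot all_order all_algebra.
From mathcomp Require Import finmap.
From mathcomp Require Import reals.

Set Implicit Arguments.
Unset Strict Implicit.
Unset Printing Implicit Defensive.

Import Order.TTheory GRing.Theory Num.Theory.

Local Open Scope fset_scope.

Section Complexes.
Variable V : choiceType.

(* A family of finite sets of vertices.  fset0 is the void complex, with no
   faces at all (the complex written as the empty set in the recursion for
   B^{d,i}_n); it differs from [fset fset0]. *)
Definition cplx := {fset {fset V}}.

Definition simplicial_complex (K : cplx) : Prop :=
  fset0 \in K /\ (forall s t : {fset V}, s \in K -> t `<=` s -> t \in K).

Definition generated (F : {fset {fset V}}) : cplx :=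
  \bigcup_(s <- F) fpowerset s.

Definition simplex (A : {fset V}) : cplx := fpowerset A.

Definition facets (K : cplx) : {fset {fset V}} :=
  [fset s in K | all (fun t => (s `<=` t) ==> (t == s)) K].

Definition join (K L : cplx) : cplx := [fset s `|` t | s in K, t in L].

Definition cone (K : cplx) (v : V) : cplx := join K (simplex [fset v]).

Definition complex_diff (K L : cplx) : cplx :=
  generated [fset s in facets K | s \notin L].

(* For K pure of dimension d: the complex generated by the (d-1)-faces (they
   have d vertices) that lie in exactly one facet. *)
Definition boundary (d : nat) (K : cplx) : cplx :=
  generated [fset t in K |
    (#|` t| == d) && (#|` [fset s in facets K | t `<=` s]| == 1)].

End Complexes.

Section PiecewiseLinear.
Variable R : realType.
Local Open Scope ring_scope.

(* |K| in barycentric coordinates: a point is a finitely supported function on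
   the vertices. *)
Definition realization (V : choiceType) (K : cplx V)
    (x : {fsfun V -> R with 0}) : Prop :=
  [/\ finsupp x \in K, (forall v, 0 <= x v) & \sum_(v <- finsupp x) x v = 1].

Definition affine_form (V : choiceType) : Type := ((V -> R) * R)%type.

Definition affine_eval (V : choiceType) (a : affine_form V)
    (x : {fsfun V -> R with 0}) : R :=
  \sum_(v <- finsupp x) a.1 v * x v + a.2.

(* The closed convex polyhedron cut out by finitely many affine inequalities. *)
Definition in_polyhedron (V : choiceType) (P : seq (affine_form V))
    (x : {fsfun V -> R with 0}) : Prop :=
  all (fun a => 0 <= affine_eval a x) P.

(* f is piecewise linear on |K|: |K| is covered by finitely many closed convex
   polyhedra P, on each of which f agrees with an affine map A (given by its
   coordinates).  Continuity follows, the pieces being closed and finite in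
   number. *)
Definition PL_on (V W : choiceType) (K : cplx V)
    (f : {fsfun V -> R with 0} -> {fsfun W -> R with 0}) : Prop :=
  exists (k : nat) (P : 'I_k -> seq (affine_form V))
         (A : 'I_k -> W -> affine_form V),
    (forall x, realization K x -> exists i, in_polyhedron (P i) x) /\
    (forall i x, realization K x -> in_polyhedron (P i) x ->
       forall w, f x w = affine_eval (A i w) x).

Definition PL_homeomorphic (V W : choiceType) (K : cplx V) (L : cplx W) : Prop :=
  exists (f : {fsfun V -> R with 0} -> {fsfun W -> R with 0})
         (g : {fsfun W -> R with 0} -> {fsfun V -> R with 0}),
    [/\ (forall x, realization K x -> realization L (f x) /\ g (f x) = x),
        (forall y, realization L y -> realization K (g y) /\ f (g y) = y),
        PL_on K f
      & PL_on L g].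

(* The boundary of the (d+1)-simplex, on the d+2 vertices 'I_d.+2. *)
Definition simplex_boundary (d : nat) : cplx 'I_d.+2 :=
  [fset s in fpowerset [fset i | i : 'I_d.+2] | s != [fset i | i : 'I_d.+2]].

Definition combinatorial_sphere (V : choiceType) (d : nat) (K : cplx V) : Prop :=
  simplicial_complex K /\ PL_homeomorphic K (simplex_boundary d).

End PiecewiseLinear.

Section SignedComplexes.
Local Open Scope ring_scope.

(* The vertices +-1, +-2, ... are nonzero integers. *)
Definition Vset (m : nat) : {fset int} :=
  [fset k%:Z | k in iota 1 m] `|` [fset - k%:Z | k in iota 1 m].

Definition neg_face (s : {fset int}) : {fset int} := [fset - v | v in s].

Definition neg (K : cplx int) : cplx int := [fset neg_face s | s in K].

Definition antipode_free (s : {fset int}) : bool :=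
  all (fun v => - v \notin s) s.

Definition crosspolytope_boundary (m : nat) : cplx int :=
  [fset s in fpowerset (Vset m) | antipode_free s].

Definition centrally_symmetric (K : cplx int) : Prop :=
  forall s, s \in K -> neg_face s \in K.

Definition vertex_set (K : cplx int) (A : {fset int}) : Prop :=
  forall v : int, ([fset v] \in K) = (v \in A).

Definition cs_neighborly (i m : nat) (K : cplx int) : Prop :=
  forall s : {fset int},
    s `<=` Vset m -> (#|` s| <= i)%N -> antipode_free s -> s \in K.

(* Replace B by the cone over its boundary with apex v, and -B by the cone over
   the boundary of -B with apex -v; B is pure of dimension d. *)
Definition cs_replace (d : nat) (D B : cplx int) (v : int) : cplx int :=
  generated [fset s in facets D | (s \notin B) && (s \notin neg B)]
  `|` cone (boundary d B) v
  `|` cone (boundary d (neg B)) (- v).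

Definition cycle_complex (c : seq int) : cplx int :=
  generated [fset [fset p.1; p.2] | p in zip c (rot 1 c)].

Definition Delta1 (n : nat) : cplx int :=
  cycle_complex ([seq k%:Z | k <- iota 1 n] ++ [seq - k%:Z | k <- iota 1 n]).

Definition B1 (i n : nat) : cplx int :=
  match i with
  | 0 => simplex [fset -1; n%:Z]
  | 1 => complex_diff (Delta1 n) (simplex [fset -1; n%:Z])
  | _ => fset0
  end.

(* The recursive formula for B^{d,i}_n, with B standing for B^{d-1}; the term
   B^{d-1,i-1} is void when i = 0. *)
Definition Bjoin (B : nat -> nat -> cplx int) (i n : nat) : cplx int :=
  cone (B i n.-1) n%:Z
  `|` (if i is j.+1 then cone (neg (B j n.-1)) (- n%:Z) else fset0).

(* Delta^d_n from B^{d-1}; only n >= d + 1 is meaningful. *)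
Fixpoint Delta_step (d : nat) (B : nat -> nat -> cplx int) (n : nat) : cplx int :=
  match n with
  | 0 => crosspolytope_boundary d.+1
  | n'.+1 =>
      if (n'.+1 <= d.+1)%N then crosspolytope_boundary d.+1
      else cs_replace d (Delta_step d B n') (Bjoin B (uphalf d).-1 n') n'.+1%:Z
  end.

(* The case i = k is the complement formula when d = 2k - 1. *)
Definition B_step (d : nat) (B : nat -> nat -> cplx int) (i n : nat) : cplx int :=
  if odd d && (i == uphalf d)
  then complex_diff (Delta_step d B n) (Bjoin B i.-1 n)
  else Bjoin B i n.

(* The pair (Delta^d, B^d) for d = e + 1. *)
Fixpoint Delta_B (e : nat) : (nat -> cplx int) * (nat -> nat -> cplx int) :=
  match e with
  | 0 => (Delta1, B1)
  | e'.+1 => let B := (Delta_B e').2 in (Delta_step e.+1 B, B_step e.+1 B)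
  end.

(* Delta^d_n and B^{d,i}_n, for d >= 1 and n >= d + 1. *)
Definition Delta (d n : nat) : cplx int := (Delta_B d.-1).1 n.
Definition B (d i n : nat) : cplx int := (Delta_B d.-1).2 i n.

(* A set i_1 < ... < i_p is the increasing list of its elements. *)
Definition index_family (n : nat) (I : seq nat) : Prop :=
  [/\ sorted ltn I,
      all (fun i => 3 <= i <= n - 6)%N I
    & (2 <= size I)%N -> (1 < nth 0 I 1 - nth 0 I 0)%N].

(* The element with position j in I (counted from 0), and n - 2 past the end. *)
Definition idx (n : nat) (I : seq nat) (j : nat) : nat := nth (n - 2)%N I j.

Definition BI_facets (n : nat) (I : seq nat) : seq {fset int} :=
  let N := n%:Z in
  [seq [fset 1; 2; i%:Z; i%:Z + 2] | i <- index_iota 3 n.-1]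
  ++ [:: [fset 1; 2; N - 1; N];
         [fset 1; - N + 2; N - 1; N];
         [fset 1; - N + 2; - N + 1; N];
         [fset 1; - N + 2; - N + 1; - N]]
  ++ [seq [fset - N + m%:Z + 1; - N + m%:Z; N - 1; N]
       | m <- index_iota 2 (idx n I 0).+1]
  ++ flatten [seq
       [fset 1; - N + (idx n I j)%:Z + 2;
             N - (idx n I j)%:Z - 1; N - (idx n I j)%:Z + 1]
       :: [seq [fset - N + m%:Z + 1; - N + m%:Z;
                     N - (idx n I j)%:Z - 1; N - (idx n I j)%:Z + 1]
            | m <- index_iota (idx n I j + 2)%N (idx n I j.+1).+1]
     | j <- iota 0 (size I)].

Definition BI (n : nat) (I : seq nat) : cplx int :=
  generated [fset s in BI_facets n I].

Definition DeltaI (n : nat) (I : seq nat) : cplx int :=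
  cs_replace 3 (Delta 3 n) (BI n I) n.+1%:Z.

End SignedComplexes.

(* Main.v *)
Require Import Defs.
From mathcomp Require Import all_boot all_order all_algebra.
From mathcomp Require Import finmap.
From mathcomp Require Import reals.
From mathcomp Require Import zify ring lra.

(* A stacked ball S is built from a simplex by repeatedly gluing a new simplex,
   with one new vertex, along a facet of an old one.  Trading S inside a sphere
   for the cone over its boundary is then a chain of bistellar flips, one per
   facet of S, and a flip A * bd B -> bd A * B is realized on barycentric
   coordinates by lowering the A-coordinates by their minimum and spreading the
   released mass evenly over B.  All faces of S of codimension at least 2 lie on
   its boundary, so no edge of the sphere is lost, while the apex becomes adjacent
   to every vertex of S.  Both B^{3,1}_n and B(I) are stacked, share no facet with
   their antipodes and use every vertex of Delta^3_n; hence each cs-replacement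
   turns a cs-2-neighborly 3-sphere on V_n into one on V_{n+1}, starting from the
   boundary of the 4-dimensional cross-polytope, which is obtained from the
   boundary of a 4-simplex by three stellar subdivisions. *)

Set Implicit Arguments.
Unset Strict Implicit.
Unset Printing Implicit Defensive.

Import Order.TTheory GRing.Theory Num.Theory.

Local Open Scope fset_scope.

(** * Piecewise linear homeomorphisms and flips *)

Section PLMaps.
Variable R : realType.
Local Open Scope ring_scope.

Implicit Types V W U : choiceType.

(** A flip at [A] is legitimate only when the facets through [A] form [A] joined with the boundary
    of [B] and nothing more. Inside a sphere this rests on codimension-one faces lying in at most
    two facets; as that is awkward to extract from a PL homeomorphism, [nonbranching] is carried as
    a separate invariant. It forces each gluing face of a stacked ball onto the boundary of the part
    built so far, and it survives a replacement because the boundary of a stacked ball is itself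
    nonbranching.

    The other obstacle is to locate the balls inside the recursively defined spheres. Each facet of
    $B^{3,1}_{n+1}$ is, up to sign, a cone with apex $n+1$ over a boundary triangle of $B^{3,1}_n$,
    so the recursion never gets stuck. A facet of $B(I)$ with a gap pair $k-1,k+1$ is created
    together with the vertex $k+1$. It contains neither $k$ nor $-k$, whereas every facet of $\pm
    B^{3,1}_{k+1}$ contains one of them and every facet of $\pm B^{3,1}_m$ contains $m$ or $-m$;
    hence no later replacement removes it. *)

Lemma sum_finsupp V (x : {fsfun V -> R with 0}) (S : {fset V}) (c : V -> R) :
  finsupp x `<=` S -> \sum_(v <- finsupp x) c v * x v = \sum_(v <- S) c v * x v.
Proof.
move=> sub; apply: big_fset_incl => // v vS.
by move=> /fsfun_dflt ->; rewrite mulr0.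
Qed.

Lemma sum_finsupp1 V (x : {fsfun V -> R with 0}) (S : {fset V}) :
  finsupp x `<=` S -> \sum_(v <- finsupp x) x v = \sum_(v <- S) x v.
Proof. by move=> sub; apply: big_fset_incl => // v _ /fsfun_dflt. Qed.

Lemma PL_on_finType V W (K : cplx V) (f : {fsfun V -> R with 0} -> {fsfun W -> R with 0})
    (T : finType) (P : T -> seq (affine_form R V)) (A : T -> W -> affine_form R V) :
  (forall x, realization K x -> exists i, in_polyhedron (P i) x) ->
  (forall i x, realization K x -> in_polyhedron (P i) x ->
       forall w, f x w = affine_eval (A i w) x) ->
  PL_on K f.
Proof.
move=> cov aff; exists #|T|, (P \o enum_val), (A \o enum_val); split.
  by move=> x /cov[i Pi]; exists (enum_rank i); rewrite /= enum_rankK.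
by move=> i x Kx Px w; exact: aff.
Qed.

(** The coefficients of [a] need not have finite support, so the finite set [S] is there to bound
    the support of the intermediate point. *)
Definition affine_comp V W (S : {fset W}) (A : W -> affine_form R V)
    (a : affine_form R W) : affine_form R V :=
  (fun v => \sum_(w <- S) a.1 w * (A w).1 v, \sum_(w <- S) a.1 w * (A w).2 + a.2).

Lemma affine_compE V W (S : {fset W}) (A : W -> affine_form R V) (a : affine_form R W)
    (x : {fsfun V -> R with 0}) (y : {fsfun W -> R with 0}) :
  finsupp y `<=` S -> (forall w, y w = affine_eval (A w) x) ->
  affine_eval (affine_comp S A a) x = affine_eval a y.
Proof.
move=> yS yA; rewrite /affine_eval /= (sum_finsupp _ yS) addrA; congr (_ + _).
under eq_bigr => v _ do rewrite mulr_suml.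
rewrite exchange_big -big_split /=; apply: eq_bigr => w _.
rewrite yA /affine_eval mulrDr mulr_sumr; congr (_ + _).
by apply: eq_bigr => v _; rewrite mulrA.
Qed.

(** The polyhedra of [g] are pulled back along each affine piece of [f]; a piece of the composite is
    indexed by a pair of pieces. *)
Lemma PL_comp V W U (K : cplx V) (L : cplx W)
    (f : {fsfun V -> R with 0} -> {fsfun W -> R with 0})
    (g : {fsfun W -> R with 0} -> {fsfun U -> R with 0}) :
  (forall x, realization K x -> realization L (f x)) ->
  PL_on K f -> PL_on L g -> PL_on K (g \o f).
Proof.
move=> fKL [k [P [A [covf Af]]]] [l [Q [C [covg Cg]]]].
pose S := \bigcup_(s <- L) s.
have SL s : s \in L -> s `<=` S by move=> sL; exact: (bigfcup_sup id).
have comp x i : realization K x -> in_polyhedron (P i) x ->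
  forall a, affine_eval (affine_comp S (A i) a) x = affine_eval a (f x).
  move=> Kx Px a; apply: affine_compE; last exact: Af.
  by case: (fKL x Kx) => /SL.
apply: (@PL_on_finType _ _ _ _ _
  (fun ij : 'I_k * 'I_l => P ij.1 ++ map (affine_comp S (A ij.1)) (Q ij.2))
  (fun ij w => affine_comp S (A ij.1) (C ij.2 w))).
  move=> x Kx; have [i Pi] := covf x Kx; have [j Qj] := covg _ (fKL x Kx).
  exists (i, j); rewrite /in_polyhedron all_cat /=; apply/andP; split => //.
  rewrite all_map; apply: sub_all Qj => a /=; by rewrite (comp _ _ Kx Pi).
move=> [i j] x Kx; rewrite /in_polyhedron all_cat /= => /andP[Pi Qj] w.
rewrite (comp _ _ Kx Pi); apply: Cg; first exact: fKL.
move: Qj; rewrite all_map; apply: sub_all => a /=; by rewrite (comp _ _ Kx Pi).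
Qed.

Lemma PL_homeomorphic_trans V W U (K : cplx V) (L : cplx W) (M : cplx U) :
  PL_homeomorphic R K L -> PL_homeomorphic R L M -> PL_homeomorphic R K M.
Proof.
move=> [f [f' [fL fK PLf PLf']]] [g [g' [gM gL PLg PLg']]].
exists (g \o f), (f' \o g'); split.
- move=> x /fL[Lfx f'f]; have [Mg g'g] := gM _ Lfx.
  by split => //=; rewrite g'g.
- move=> x /gL[Lfx f'f]; have [Mg g'g] := fK _ Lfx.
  by split => //=; rewrite g'g.
- by apply: PL_comp PLf PLg => x /fL[].
- by apply: PL_comp PLg' PLf' => x /gL[].
Qed.

Lemma PL_homeomorphic_sym V W (K : cplx V) (L : cplx W) :
  PL_homeomorphic R K L -> PL_homeomorphic R L K.
Proof. by move=> [f [f' [? ? ? ?]]]; exists f', f; split. Qed.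

(** The only shape of affine form that the explicit maps require: [c = 0] reads a coordinate,
    [c = -1] compares two of them, and a flip coefficient describes a flip on one of its pieces. *)
Definition two_term V (w : V) (c : R) (u : V) : affine_form R V :=
  (fun v => (v == w)%:R + c * (v == u)%:R, 0).

Lemma sum_delta V (x : {fsfun V -> R with 0}) w :
  \sum_(v <- finsupp x) (v == w)%:R * x v = x w.
Proof.
rewrite (sum_finsupp _ (fsubsetU1 w (finsupp x))) (big_fsetD1 w) ?fset1U1 //=.
rewrite eqxx mul1r big1_fset ?addr0 // => v; rewrite !inE => /andP[/negPf -> _] _.
by rewrite mul0r.
Qed.

Lemma two_termE V w c u (x : {fsfun V -> R with 0}) :
  affine_eval (two_term w c u) x = x w + c * x u.
Proof.
rewrite /affine_eval addr0 /= -(sum_delta x w) -(sum_delta x u) mulr_sumr -big_split.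
by apply: eq_bigr => v _ /=; rewrite mulrDl mulrA.
Qed.

Lemma PL_homeomorphic_refl V (K : cplx V) : PL_homeomorphic R K K.
Proof.
have idPL : PL_on K (fun x : {fsfun V -> R with 0} => x).
  apply: (@PL_on_finType _ _ _ _ unit (fun=> [::]) (fun=> fun v => two_term v 0 v)).
    by move=> x _; exists tt.
  by move=> _ x _ _ v; rewrite two_termE mul0r addr0.
by exists id, id.
Qed.

Section Relabel.
Variables (V W : choiceType) (h : V -> W) (h' : W -> V) (K : cplx V) (L : cplx W).
Hypotheses (hK : cancel h h') (h'K : forall s w, s \in L -> w \in s -> h (h' w) = w).
Hypotheses (KL : forall s, s \in K -> h @` s \in L) (LK : forall t, t \in L -> h' @` t \in K).

Lemma relabel_homeomorphic : PL_homeomorphic R K L.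
Proof.
pose f (x : {fsfun V -> R with 0}) : {fsfun W -> R with 0} :=
  [fsfun w in h @` finsupp x => x (h' w)].
pose g (y : {fsfun W -> R with 0}) : {fsfun V -> R with 0} :=
  [fsfun v in h' @` finsupp y => y (h v)].
have inj_h : injective h := can_inj hK.
have fh x v : f x (h v) = x v.
  by rewrite fsfunE mem_imfset //= hK mem_finsupp; case: eqP.
have gE y v : finsupp y \in L -> g y v = y (h v).
  move=> yL; rewrite fsfunE; case: ifPn => // /negP vy; case: (finsuppP y (h v)) => // hv.
  by case: vy; apply/imfsetP; exists (h v); rewrite ?hK.
have fsupp x : finsupp (f x) = h @` finsupp x.
  apply/fsetP => w; rewrite mem_finsupp fsfunE; case: imfsetP => [[v vx ->]|_].
    by rewrite hK -mem_finsupp.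
  by rewrite eqxx.
have gsupp y : finsupp y \in L -> finsupp (g y) = h' @` finsupp y.
  move=> yL; apply/fsetP => v; rewrite mem_finsupp gE // -mem_finsupp.
  apply/idP/imfsetP => [vy|[w wy ->]] /=; first by exists (h v); rewrite ?hK.
  by rewrite (h'K yL wy).
have gf x : g (f x) = x.
  apply/fsfunP => v; rewrite fsfunE fsupp fh; case: imfsetP => // nv.
  case: (finsuppP x v) => // vx; case: nv; exists (h v); rewrite ?hK //=.
  by rewrite mem_imfset.
have fg y : realization L y -> f (g y) = y.
  case=> yL _ _; apply/fsfunP => w; case: (finsuppP y w) => wy.
    rewrite fsfun_dflt // fsupp gsupp //; apply/negP => /imfsetP[v /imfsetP[u uy ->]] wE.
    by move: wy; rewrite wE (h'K yL uy) uy.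
  by rewrite -{1}(h'K yL wy) fh gE // (h'K yL wy).
exists f, g; split.
- move=> x [Kx x0 x1]; split; last exact: gf.
  split; first by rewrite fsupp KL.
    by move=> w; rewrite fsfunE; case: ifP.
  rewrite fsupp big_imfset /=; last by move=> ? ? _ _ /inj_h.
  by rewrite -x1; apply: eq_bigr => v _; rewrite fh.
- move=> y yL; split; last exact: fg.
  have [Ly y0 y1] := yL; split; first by rewrite gsupp // LK.
    by move=> w; rewrite gE.
  rewrite gsupp // big_imfset /=; last first.
    by move=> u v uy vy uv; rewrite -(h'K Ly uy) -(h'K Ly vy) uv.
  rewrite -y1 !big_seq; apply: eq_bigr => w wy; rewrite gE // (h'K Ly wy) //.
(* Off the vertices of [L] the point [f x] vanishes, whereas [h' w] may be an unrelated vertex; the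
   zero form is used there. *)
- pose W0 := \bigcup_(s <- L) s.
  apply: (@PL_on_finType _ _ _ _ unit (fun=> [::])
    (fun=> fun w => if w \in W0 then two_term (h' w) 0 (h' w) else (fun=> 0, 0))).
    by move=> x _; exists tt.
  move=> _ x [Kx x0 x1] _ w; case: ifPn => wW.
    rewrite two_termE mul0r addr0; have [s /andP[sL _] ws] := bigfcupP _ _ _ _ wW.
    by rewrite -(fh x) (h'K sL ws).
  rewrite /affine_eval addr0 big1 ?fsfunE; last by move=> *; rewrite mul0r.
  case: ifP => // wx; case/negP: wW; apply/bigfcupP; exists (h @` finsupp x) => //.
  by rewrite KL.
- apply: (@PL_on_finType _ _ _ _ unit (fun=> [::]) (fun=> fun v => two_term (h v) 0 (h v))).
    by move=> x _; exists tt.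
  by move=> _ y [yL _ _] _ v; rewrite two_termE mul0r addr0 gE.
Qed.

End Relabel.

Section Flip.
Variable V : choiceType.
Implicit Types (K L : cplx V) (A B : {fset V}).

(* [K] contains [A * boundary B * M] where [L] contains [boundary A * B * M]:
   a bistellar flip, or a stellar subdivision at [A] when [B] is a new vertex. *)
Definition flip_cond K L A B : Prop := forall s, s \in K ->
  [/\ ~~ (B `<=` s), (~~ (A `<=` s) -> s \in L)
    & (A `<=` s -> forall a, a \in A -> (s `\ a) `|` B \in L)].

(** The least coordinate on [A], looked up by position so that no default vertex is required; the
    value is 0 on the empty set. *)
Definition fmin A (x : {fsfun V -> R with 0}) : R :=
  nth 0 [seq x a | a <- A] (find (fun a => all (fun b => x a <= x b) A) A).

Lemma fminP A (x : {fsfun V -> R with 0}) : A != fset0 ->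
  (exists2 a, a \in A & fmin A x = x a) /\ (forall b, b \in A -> fmin A x <= x b).
Proof.
move=> /fset0Pn[a0 a0A].
have hasA : has (fun a => all (fun b => x a <= x b) A) A.
  have [a aA amin] := @arg_minP _ _ _ [` a0A] predT (fun a : A => x (val a)) isT.
  apply/hasP; exists (val a); first exact: valP.
  by apply/allP => b bA; exact: (amin [` bA]).
rewrite /fmin (nth_map a0) -?has_find //; split.
  set i := find _ _; exists (nth a0 A i) => //.
  by apply: mem_nth; rewrite -has_find.
by move=> b bA; move/(nth_find a0)/allP: hasA; apply.
Qed.

Lemma fmin_eq A (x : {fsfun V -> R with 0}) m : (exists2 a, a \in A & m = x a) ->
  (forall b, b \in A -> m <= x b) -> fmin A x = m.
Proof.
move=> [a aA ma] mle; have A0 : A != fset0 by apply/fset0Pn; exists a.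
have [[b bA fb] fle] := fminP x A0.
by apply/eqP; rewrite eq_le {1}ma fle // fb mle.
Qed.

(** Rate of change per unit of released minimum: [A] gives up one unit at each of its vertices, so
    each vertex of [B] must receive $|A|/|B|$ to keep the total mass. *)
Definition flip_coef A B (v : V) : R :=
  if v \in A then -1 else if v \in B then #|` A|%:R / #|` B|%:R else 0.

(* For [x] in [A * boundary B], moves the least [A]-coordinate to zero and
   spreads the mass taken from [A] evenly over [B]; it fixes the points whose
   support does not contain [A]. *)
Definition flip_map A B (x : {fsfun V -> R with 0}) : {fsfun V -> R with 0} :=
  [fsfun v in finsupp x `|` A `|` B => x v + flip_coef A B v * fmin A x].

Lemma flip_mapE A B x v : flip_map A B x v = x v + flip_coef A B v * fmin A x.
Proof.
rewrite fsfunE; case: ifPn => //; rewrite !inE !negb_or -andbA => /and3P[vx vA vB].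
by rewrite fsfun_dflt // /flip_coef (negPf vA) (negPf vB) mul0r addr0.
Qed.

Lemma fmin0 K A x : A != fset0 -> realization K x -> ~~ (A `<=` finsupp x) -> fmin A x = 0.
Proof.
move=> A0 [_ x0 _] /fsubsetPn[a aA ax]; apply: fmin_eq => [|b _]; last exact: x0.
by exists a => //; rewrite fsfun_dflt.
Qed.

Lemma sum_indicator A (S : {fset V}) : A `<=` S -> \sum_(v <- S) (v \in A)%:R = #|` A|%:R :> R.
Proof.
move=> AS; rewrite -(big_fset_incl _ AS) => [|v _ /negPf -> //].
rewrite (eq_big_seq (fun=> 1)) => [|v -> //].
by rewrite big_const_seq count_predT iter_addr_0.
Qed.

Lemma sum_flip_coef A B (S : {fset V}) : [disjoint A & B] -> B != fset0 ->
  A `<=` S -> B `<=` S -> \sum_(v <- S) flip_coef A B v = 0.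
Proof.
move=> dAB B0 AS BS.
rewrite (eq_bigr (fun v => - (v \in A)%:R + #|` A|%:R / #|` B|%:R * (v \in B)%:R)); last first.
  move=> v _; rewrite /flip_coef; case: (boolP (v \in A)) => [vA|_].
    by rewrite (negPf (fdisjointP dAB _ vA)) mulr0 addr0.
  by case: ifP => _; rewrite oppr0 add0r ?mulr1 ?mulr0.
rewrite big_split sumrN -mulr_sumr !sum_indicator //= mulfVK ?addNr //.
by rewrite pnatr_eq0 cardfs_eq0.
Qed.

Section OneWay.
Variables (K L : cplx V) (A B : {fset V}).
Hypotheses (A0 : A != fset0) (B0 : B != fset0) (dAB : [disjoint A & B]).
Hypotheses (Lcl : forall s t, s \in L -> t `<=` s -> t \in L) (KL : flip_cond K L A B).

Let cB_gt0 : 0 < #|` B|%:R :> R. Proof. by rewrite ltr0n cardfs_gt0. Qed.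
Let cA_gt0 : 0 < #|` A|%:R :> R. Proof. by rewrite ltr0n cardfs_gt0. Qed.

Lemma flip_map_id x : realization K x -> ~~ (A `<=` finsupp x) -> flip_map A B x = x.
Proof.
by move=> Kx nA; apply/fsfunP => v; rewrite flip_mapE (fmin0 A0 Kx) // mulr0 addr0.
Qed.

Lemma flip_map_realization x : realization K x -> realization L (flip_map A B x).
Proof.
move=> Kx; have [/KL[nB xL AL] x0 x1] := Kx.
case: (boolP (A `<=` finsupp x)) => [Ax|nAx]; last by rewrite flip_map_id //; split; auto.
have [[a aA fa] fle] := fminP x A0.
(* The vertex [a] attaining the minimum drops to zero, so it leaves the support while [B] enters
   it. *)
have supp : finsupp (flip_map A B x) `<=` (finsupp x `\ a) `|` B.
  apply/fsubsetP => v; rewrite mem_finsupp flip_mapE !inE mem_finsupp.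
  have [->|va] := eqVneq v a; first by rewrite /flip_coef aA fa mulN1r subrr eqxx.
  case: (boolP (v \in B)) => [|vB]; rewrite ?orbT //= orbF.
  rewrite /flip_coef (negPf vB); case: (boolP (v \in A)) => [vA _|_].
    by rewrite -mem_finsupp (fsubsetP Ax).
  by rewrite mul0r addr0.
split.
- by apply: Lcl supp; exact: AL.
- move=> v; rewrite flip_mapE /flip_coef; case: ifP => [vA|_]; first by rewrite mulN1r subr_ge0 fle.
  case: ifP => _; last by rewrite mul0r addr0.
  by rewrite addr_ge0 // mulr_ge0 ?divr_ge0 ?ler0n // fa.
- have sub : finsupp (flip_map A B x) `<=` finsupp x `|` B.
    by apply: fsubset_trans supp _; apply: fsetSU; exact: fsubD1set.
  rewrite (sum_finsupp1 sub); under eq_bigr do rewrite flip_mapE.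
  rewrite big_split /= -mulr_suml sum_flip_coef ?mul0r ?addr0 //; last exact: fsubsetUr.
    by rewrite -(sum_finsupp1 (fsubsetUl _ B)).
  exact: fsubset_trans Ax (fsubsetUl _ _).
Qed.

(** Some vertex of [B] has coordinate zero in [x], so after the flip the minimum over [B] is exactly
    the share that was added. The reverse flip therefore removes precisely that share and returns
    [fmin A x] to every vertex of [A]. *)
Lemma flip_mapK x : realization K x -> flip_map B A (flip_map A B x) = x.
Proof.
move=> Kx; have [/KL[nB _ _] x0 x1] := Kx.
have mB : fmin B x = 0 by exact: (fmin0 B0 Kx).
have [[b bB fb] _] := fminP x B0; rewrite mB in fb.
have disjB v : v \in B -> (v \in A) = false.
  by move=> vB; apply: negbTE; exact: (fdisjointP_sym dAB).
have mu0 : 0 <= fmin A x by have [[a _ ->] _] := fminP x A0.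
have m' : fmin B (flip_map A B x) = #|` A|%:R / #|` B|%:R * fmin A x.
  apply: fmin_eq => [|c cB]; rewrite ?flip_mapE /flip_coef.
    by exists b => //; rewrite flip_mapE /flip_coef bB disjB // -fb add0r.
  by rewrite cB disjB // lerDr.
apply/fsfunP => v; rewrite flip_mapE m' flip_mapE -addrA -[RHS]addr0; congr (_ + _).
rewrite /flip_coef; case: ifP => [vA|nvA].
  case: ifP => [/disjB|_]; first by rewrite vA.
  by rewrite mulrA mulN1r; field; rewrite !lt0r_neq0.
by case: ifP => _; ring.
Qed.

(** One piece for each [a] in [A]: where [a] attains the minimum, [fmin] is the coordinate [x a],
    and the flip is affine. *)
Lemma flip_map_PL : PL_on K (flip_map A B).
Proof.
apply: (@PL_on_finType _ _ _ _ A (fun a => [seq two_term b (-1) (val a) | b <- A])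
  (fun a w => two_term w (flip_coef A B w) (val a))).
  move=> x _; have [[a aA fa] fle] := fminP x A0.
  exists [` aA]; rewrite /in_polyhedron all_map; apply/allP => b bA /=.
  by rewrite two_termE mulN1r subr_ge0 -fa fle.
move=> a x _; rewrite /in_polyhedron all_map => /allP amin w.
rewrite two_termE flip_mapE (@fmin_eq _ _ (x (val a))) //; first by exists (val a) => //; exact: valP.
by move=> b /amin /=; rewrite two_termE mulN1r subr_ge0.
Qed.

End OneWay.

Lemma flip_homeomorphic K L A B :
  A != fset0 -> B != fset0 -> [disjoint A & B] ->
  (forall s t, s \in K -> t `<=` s -> t \in K) ->
  (forall s t, s \in L -> t `<=` s -> t \in L) ->
  flip_cond K L A B -> flip_cond L K B A -> PL_homeomorphic R K L.
Proof.
move=> A0 B0 dAB Kcl Lcl KL LK; have dBA : [disjoint B & A] by rewrite fdisjoint_sym.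
exists (flip_map A B), (flip_map B A); split.
- by move=> x Kx; split; [apply: (flip_map_realization (K := K))|apply: (flip_mapK (K := K) (L := L))].
- by move=> x Lx; split; [apply: (flip_map_realization (K := L))|apply: (flip_mapK (K := L) (L := K))].
- exact: flip_map_PL.
- exact: flip_map_PL.
Qed.

End Flip.
End PLMaps.

(** * Stacked balls *)

Section Generated.
Variable V : choiceType.
Implicit Types (F G S : {fset {fset V}}) (s t f : {fset V}) (v : V).

Lemma generatedP F s : reflect (exists2 f, f \in F & s `<=` f) (s \in generated F).
Proof.
apply: (iffP (bigfcupP _ _ _ _)) => [[f]|[f]]; last by exists f; rewrite ?fpowersetE ?andbT.
by rewrite andbT fpowersetE; exists f.
Qed.

Lemma generated_closed F s t : s \in generated F -> t `<=` s -> t \in generated F.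
Proof.
by move=> /generatedP[f fF sf] ts; apply/generatedP; exists f; rewrite ?(fsubset_trans ts).
Qed.

Lemma simplicial_complex_generated F : F != fset0 -> simplicial_complex (generated F).
Proof.
move=> /fset0Pn[f fF]; split; last by move=> s t; exact: generated_closed.
by apply/generatedP; exists f; rewrite ?fsub0set.
Qed.

Lemma facets_generated k F : {in F, forall f, #|` f| = k} -> facets (generated F) = F.
Proof.
move=> size_F; apply/fsetP => s; rewrite !inE /=; apply/andP/idP => [[/generatedP[f fF sf]]|sF].
  move=> /allP/(_ f); rewrite sf /= => H; rewrite -(eqP (H _)) //.
  by apply/generatedP; exists f.
split; first by apply/generatedP; exists s.
apply/allP => t /generatedP[f fF tf]; apply/implyP => st.
have sf := fsubset_trans st tf.
have /eqP E : s == f by rewrite eqEfcard sf (size_F _ sF) (size_F _ fF) leqnn.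
by rewrite eqEfsubset st andbT E.
Qed.

Lemma generatedU F G : generated F `|` generated G = generated (F `|` G).
Proof.
apply/fsetP => s; rewrite inE; apply/orP/generatedP => [[]/generatedP[f fF sf]|[f]].
- by exists f; rewrite ?inE ?fF.
- by exists f; rewrite ?inE ?fF ?orbT.
- by rewrite inE => /orP[] fF sf; [left|right]; apply/generatedP; exists f.
Qed.

Lemma simplexE s : simplex s = generated [fset s].
Proof.
apply/fsetP => t; rewrite fpowersetE; apply/idP/generatedP => [ts|[f /fset1P ->] //].
by exists s; rewrite ?fset11.
Qed.

Lemma cone_generated F v : cone (generated F) v = generated [fset v |` f | f in F].
Proof.
apply/fsetP => s; apply/imfset2P/generatedP => /= [[t /generatedP[f fF tf]]|].
  move=> [u]; rewrite fpowersetE => uv ->; exists (v |` f).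
    by apply/imfsetP; exists f.
  by rewrite fsetUC fsetUSS.
move=> [_ /imfsetP[f /= fF ->] sf]; exists (s `\ v).
  by apply/generatedP; exists f; rewrite // fsubDset.
exists (s `&` [fset v]); first by rewrite fpowersetE fsubsetIr.
apply/fsetP => x; rewrite !inE; case: (x == v); rewrite ?andbT ?andbF ?orbF //=.
Qed.

End Generated.

Lemma neg_faceK : involutive neg_face.
Proof.
move=> s; rewrite /neg_face -imfset_comp /= -[RHS]imfset_id.
by apply: eq_imfset => // x; rewrite /= opprK.
Qed.

Lemma in_neg_face (s : {fset int}) v : (v \in neg_face s) = ((- v)%R \in s).
Proof.
rewrite -{1}[v]opprK mem_imfset //; exact: (can_inj opprK).
Qed.

Lemma neg_faceS (s t : {fset int}) : (neg_face s `<=` neg_face t) = (s `<=` t).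
Proof.
have H s' t' : s' `<=` t' -> neg_face s' `<=` neg_face t'.
  by move=> /fsubsetP st; apply/fsubsetP => x; rewrite !in_neg_face => /st.
by apply/idP/idP; [rewrite -{2}[s]neg_faceK -{2}[t]neg_faceK|]; exact: H.
Qed.

Lemma card_neg_face s : #|` neg_face s| = #|` s|.
Proof. by rewrite card_imfset //; exact: (can_inj opprK). Qed.

Lemma in_neg (K : cplx int) s : (s \in neg K) = (neg_face s \in K).
Proof. by rewrite -{1}[s]neg_faceK mem_imfset //; exact: (can_inj neg_faceK). Qed.

Lemma neg_generated F : neg (generated F) = generated (neg F).
Proof.
apply/fsetP => s; rewrite in_neg; apply/generatedP/generatedP => -[f fF sf].
  by exists (neg_face f); rewrite ?in_neg ?neg_faceK // -neg_faceS neg_faceK.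
by exists (neg_face f); rewrite -?in_neg // neg_faceS.
Qed.

Section Stacked.
Variables (V : choiceType) (d : nat).
Implicit Types (F G S : {fset {fset V}}) (s t r f g h e : {fset V}) (v w a : V).

Definition ridges S : {fset {fset V}} :=
  [fset t in generated S | (#|` t| == d) && (#|` [fset s in S | t `<=` s]| == 1)].

Lemma ridgesP S t : reflect
  (#|` t| = d /\ exists f, [/\ f \in S, t `<=` f & forall g, g \in S -> t `<=` g -> g = f])
  (t \in ridges S).
Proof.
rewrite !inE /=; apply: (iffP and3P) => [[_ /eqP tn /cardfs1P[f Sf]]|[tn [f [fS tf uf]]]].
  split => //; exists f; have := fset11 f; rewrite -Sf !inE => /andP[fS tf]; split => //.
  by move=> g gS tg; apply/fset1P; rewrite -Sf !inE gS.
split; [by apply/generatedP; exists f|by rewrite tn|].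
apply/cardfs1P; exists f; apply/fsetP => g; rewrite !inE /=.
by apply/andP/eqP => [[gS tg]|->]; [exact: uf|].
Qed.

Lemma card_ridge S t : t \in ridges S -> #|` t| = d.
Proof. by case/ridgesP. Qed.

Lemma boundary_generated S : {in S, forall f, #|` f| = d.+1} ->
  boundary d (generated S) = generated (ridges S).
Proof. by move=> /facets_generated; rewrite /boundary => ->. Qed.

(** That the gluing face [t] lies on the boundary of [S] is not part of the data; inside a
    nonbranching family it follows by [nonbranching_ridge]. *)
Inductive stacked : {fset {fset V}} -> Prop :=
| stacked1 s : #|` s| = d.+1 -> stacked [fset s]
| stackedU S f t w : stacked S -> f \in S -> t `<=` f -> #|` t| = d ->
    {in S, forall g, w \notin g} -> stacked ((w |` t) |` S).

Lemma stacked_size S : stacked S -> {in S, forall f, #|` f| = d.+1}.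
Proof.
elim=> [s sd f /fset1P -> //|{}S f t w _ IH fS tf td wS g /fset1UP[->|]]; last exact: IH.
by rewrite cardfsU1 td (contra _ (wS _ fS)) // => /(fsubsetP tf).
Qed.

Lemma card_subset_eq s t : s `<=` t -> #|` t| <= #|` s| -> s = t.
Proof. by move=> st ts; apply/eqP; rewrite eqEfcard st. Qed.

Lemma subset_corank1 s t : s `<=` t -> #|` t| = #|` s|.+1 ->
  exists2 a, a \in t & s = t `\ a.
Proof.
move=> st ts; have /fsubsetPn[a ta sa] : ~~ (t `<=` s).
  by apply/negP => /fsubset_leq_card; rewrite ts ltnn.
exists a => //; apply: card_subset_eq; first by rewrite fsubsetD1 st.
by have := cardfsD1 a t; rewrite ta ts => -[->].
Qed.

(* Two vertices are left over from [e], and each of the three sets takes one. *)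
Lemma subset_corank2 e s f g h : #|` s| = #|` e|.+2 ->
  [/\ e `<=` f, e `<=` g & e `<=` h] -> [/\ f `<=` s, g `<=` s & h `<=` s] ->
  [/\ #|` f| = #|` e|.+1, #|` g| = #|` e|.+1 & #|` h| = #|` e|.+1] ->
  [\/ f = g, g = h | f = h].
Proof.
move=> se [ef eg eh] [fs gs hs] [fe ge he].
have es := fsubset_trans ef fs.
have mk r : e `<=` r -> r `<=` s -> #|` r| = #|` e|.+1 ->
    exists2 a, a \in s `\` e & r = a |` e.
  move=> er rs re; have /cardfs1P[a ae] : #|` r `\` e| == 1.
    by rewrite cardfsDS // re subSnn.
  have := fset11 a; rewrite -ae inE => /andP[ane ar]; exists a.
    by rewrite inE ane (fsubsetP rs).
  by rewrite -ae fsetUC -{1}(fsetUidPr _ _ er) fsetUDl fsetDv fsetD0.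
have [a aS ->] := mk _ ef fs fe; have [b bS ->] := mk _ eg gs ge.
have [c cS ->] := mk _ eh hs he.
have [->|ab] := eqVneq a b; first by constructor 1.
have [->|bc] := eqVneq b c; first by constructor 2.
have [->|ac] := eqVneq a c; first by constructor 3.
have : #|` c |` [fset a; b]| <= #|` s `\` e|.
  apply: fsubset_leq_card; apply/fsubsetP => x; rewrite !inE => /or3P[] /eqP ->;
  by move: aS bS cS; rewrite !inE.
by rewrite cardfsU1 cardfs2 !inE ab eq_sym (negPf ac) eq_sym (negPf bc) cardfsDS // se -addn2 addKn.
Qed.

Section Extension.
Variables (S : {fset {fset V}}) (f t : {fset V}) (w : V).
Hypotheses (fS : f \in S) (tf : t `<=` f) (td : #|` t| = d) (wS : {in S, forall g, w \notin g}).

Lemma apex_notin_base : w \notin t.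
Proof. by apply: contra (wS fS) => /(fsubsetP tf). Qed.

Lemma extension_notin : w |` t \notin S.
Proof. by apply/negP => /wS; rewrite fset1U1. Qed.

Lemma sub_base s : s `<=` w |` t -> w \notin s -> s `<=` t.
Proof.
move=> /fsubsetP st ws; apply/fsubsetP => x xs; move: (st _ xs); rewrite !inE.
by case/orP=> // /eqP xw; rewrite -xw xs in ws.
Qed.

Lemma ridge_apex_notin r : r \in ridges S -> w \notin r.
Proof. by case/ridgesP => _ [g [gS rg _]]; apply: contra (wS gS) => /(fsubsetP rg). Qed.

(** Gluing along [t] hides [t] and exposes the other facets of the new simplex. This lemma and the
    next two record how the boundary changes. *)
Lemma ridges_extension_old r : r \in ridges S -> r != t -> r \in ridges ((w |` t) |` S).
Proof.
move=> rS rt; have wr := ridge_apex_notin rS; have /ridgesP[rd [g [gS rg ug]]] := rS.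
apply/ridgesP; split => //; exists g; split => // [|h]; first by rewrite !inE gS orbT.
case/fset1UP => [->|/ug //] /sub_base/(_ wr) rt'; case/eqP: rt.
by apply: card_subset_eq => //; rewrite td rd.
Qed.

Lemma ridges_extension_new a : a \in t -> w |` (t `\ a) \in ridges ((w |` t) |` S).
Proof.
move=> at_; apply/ridgesP; split.
  rewrite cardfsU1 !inE (negPf apex_notin_base) andbF /= add1n.
  by have := cardfsD1 a t; rewrite at_ td.
exists (w |` t); split; first by rewrite fset1U1.
  by apply: fsetUS; exact: fsubD1set.
move=> g /fset1UP[-> //|gS] /fsubsetP/(_ w); rewrite fset1U1 => /(_ isT) wg.
by move: (wS gS); rewrite wg.
Qed.

Lemma ridges_extension_inv r : 0 < d -> r \in ridges ((w |` t) |` S) ->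
  (r \in ridges S /\ r != t) \/ exists2 a, a \in t & r = w |` (t `\ a).
Proof.
move=> d0 /ridgesP[rd [g [gS rg ug]]]; case: (boolP (w \in r)) => wr.
  right; have rt : r `<=` w |` t.
    case/fset1UP: gS => [<- //|/wS]; by rewrite (fsubsetP rg).
  have [||a at_ ra] := @subset_corank1 (r `\ w) t.
  - by rewrite fsubDset.
  - by have := cardfsD1 w r; rewrite wr rd td.
  by exists a => //; rewrite -ra fsetD1K.
have rt : r != t.
  apply/eqP => rt; have tg : w |` t = f.
    have -> : w |` t = g by apply: ug; rewrite ?fset1U1 // rt fsubsetU1.
    by apply/esym/ug; rewrite ?rt // !inE fS orbT.
  by move: extension_notin; rewrite tg fS.
left; split => //; apply/ridgesP; split => //; exists g; split => //.
  case/fset1UP: gS => // gt; case/eqP: rt; rewrite gt in rg.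
  by apply: card_subset_eq; [exact: sub_base rg wr|rewrite rd td].
by move=> h hS; apply: ug; rewrite !inE hS orbT.
Qed.

End Extension.

(** The only boundary facet that a gluing destroys is [t]. A face inside [t] with fewer than [d]
    vertices misses some [a] in [t], hence moves to the newly exposed ridge [w |] (t [\ a)]. *)
Lemma stacked_coridge S s f : 1 < d -> stacked S -> f \in S -> s `<=` f -> #|` s| < d ->
  exists2 r, r \in ridges S & s `<=` r.
Proof.
move=> d1 stS; elim: stS f => [g gd f /fset1P -> sg sd|{}S g t w _ IH gS tg td wS f].
  have : 0 < #|` g `\` s| by rewrite cardfsDS // gd subn_gt0 ltnS ltnW.
  rewrite cardfs_gt0 => /fset0Pn[a]; rewrite inE => /andP[as_ ag].
  exists (g `\ a); last by rewrite fsubsetD1 sg.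
  apply/ridgesP; split; first by have := cardfsD1 a g; rewrite ag gd => -[].
  by exists g; split; rewrite ?fset11 ?fsubD1set // => h /fset1P.
have wt := apex_notin_base gS tg wS.
have shrink u : u `<=` t -> #|` u| < d -> exists2 a, a \in t & u `<=` t `\ a.
  move=> ut ud; have : 0 < #|` t `\` u| by rewrite cardfsDS // td subn_gt0.
  rewrite cardfs_gt0 => /fset0Pn[a]; rewrite inE => /andP[au at_].
  by exists a => //; rewrite fsubsetD1 ut.
case/fset1UP => [-> sf sd|fS sf sd].
  have [||a at_ sa] := shrink (s `\ w); first by rewrite fsubDset.
    by apply: leq_ltn_trans sd; apply: fsubset_leq_card; exact: fsubD1set.
  exists (w |` (t `\ a)); first exact: (ridges_extension_new gS tg td wS).
  by rewrite -fsubDset.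
have [r rS sr] := IH f fS sf sd.
have [rt|rt] := eqVneq r t; last by exists r => //; exact: ridges_extension_old.
rewrite rt in sr; have [a at_ sa] := shrink s sr sd.
exists (w |` (t `\ a)); first exact: (ridges_extension_new gS tg td wS).
by apply: fsubset_trans sa _; exact: fsubsetU1.
Qed.

(** The pseudomanifold condition that at most two members contain a given [k]-set, phrased without
    counting: among any three such members two coincide. *)
Definition nonbranching (k : nat) F : Prop := forall t f g h, #|` t| = k ->
  [/\ f \in F, g \in F & h \in F] -> [/\ t `<=` f, t `<=` g & t `<=` h] ->
  [\/ f = g, g = h | f = h].

Lemma nonbranching_ridge F S f t w : nonbranching d F ->
  f \in S -> t `<=` f -> #|` t| = d -> {in S, forall g, w \notin g} ->
  (w |` t) |` S `<=` F -> t \in ridges S.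
Proof.
move=> nbF fS tf td wS /fsubsetP SF; apply/ridgesP; split => //; exists f; split => //.
move=> g gS tg; case: (nbF t (w |` t) f g td) => //.
- by split; apply: SF; rewrite !inE ?eqxx ?fS ?gS ?orbT.
- by split=> //; exact: fsubsetU1.
- by move=> E; move: (wS _ fS); rewrite -E fset1U1.
- by move=> E; move: (wS _ gS); rewrite -E fset1U1.
Qed.

Lemma ridges_nonbranching F S : 0 < d -> nonbranching d F -> S `<=` F -> stacked S ->
  nonbranching d.-1 (ridges S).
Proof.
move=> d0 nbF SF stS; elim: stS SF => [s sd _|{}S f t w stS IH fS tf td wS SF].
  move=> e f g h ed [fS gS hS] He.
  have sub r : r \in ridges [fset s] -> r `<=` s.
    by case/ridgesP => _ [g' [/fset1P -> rs _]].
  apply: (@subset_corank2 e s) => //; rewrite ?ed ?prednK ?sd //; split;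
    by first [exact: sub|exact: (card_ridge fS)|exact: (card_ridge gS)|exact: (card_ridge hS)].
have {}IH := IH (fsubset_trans (fsubsetUr _ _) SF).
have tS := nonbranching_ridge nbF fS tf td wS SF.
have wt := apex_notin_base fS tf wS.
move=> e r1 r2 r3 ed [h1 h2 h3] [e1 e2 e3].
have inv := ridges_extension_inv fS tf td wS d0.
have new_sub r a : r = w |` (t `\ a) -> r `<=` w |` t.
  by move=> ->; apply: fsetUS; exact: fsubD1set.
case: (boolP (w \in e)) => we.
  have sub r : r \in ridges ((w |` t) |` S) -> e `<=` r -> r `<=` w |` t.
    move=> /inv[[rS _]|[a _ /new_sub //]] /fsubsetP/(_ _ we) wr.
    by move: (ridge_apex_notin wS rS); rewrite wr.
  apply: (@subset_corank2 e (w |` t)) => //.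
  - by rewrite cardfsU1 wt td ed prednK.
  - by split; exact: sub.
  - by rewrite ed prednK // (card_ridge h1) (card_ridge h2) (card_ridge h3).
have newE r : (exists2 a, a \in t & r = w |` (t `\ a)) -> #|` r| = d -> e `<=` r ->
    e `<=` t /\ r = w |` e.
  move=> [a at_ ra] rd er.
  have et : e `<=` t `\ a.
    by apply: (@sub_base _ w) => //; rewrite -ra.
  split; first exact: fsubset_trans et (fsubD1set _ _).
  rewrite ra; congr (w |` _); apply/esym/card_subset_eq => //.
  by have := cardfsD1 a t; rewrite at_ td ed => ->.
(* When a new ridge passes through [e], the hidden ridge [t] does too; it already occupies one of
   the two places among the old ridges. *)
have tt (r r' : {fset V}) : r \in ridges S -> r' \in ridges S -> r != t -> r' != t ->
    e `<=` t -> e `<=` r -> e `<=` r' -> r = r'.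
  move=> rS r'S /eqP rt /eqP r't et er er'.
  by case: (IH e r r' t ed).
case: (inv _ h1) => [[s1 t1]|/newE/(_ (card_ridge h1) e1)[et E1]];
case: (inv _ h2) => [[s2 t2]|/newE/(_ (card_ridge h2) e2)[et2 E2]];
case: (inv _ h3) => [[s3 t3]|/newE/(_ (card_ridge h3) e3)[et3 E3]].
- by apply: (IH e).
- by constructor 1; apply: tt.
- by constructor 3; apply: tt.
- by constructor 2; rewrite E2 E3.
- by constructor 2; apply: tt.
- by constructor 3; rewrite E1 E3.
- by constructor 1; rewrite E1 E2.
- by constructor 1; rewrite E1 E2.
Qed.

(** * Replacing a stacked ball by the cone over its boundary *)

Definition restack F S v : {fset {fset V}} :=
  [fset f in F | f \notin S] `|` [fset v |` t | t in ridges S].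

Lemma restackP F S v g : reflect
  ((g \in F /\ g \notin S) \/ exists2 t, t \in ridges S & g = v |` t) (g \in restack F S v).
Proof.
rewrite !inE /=; apply: (iffP orP) => -[].
- by case/andP; left.
- by case/imfsetP => t /= tS ->; right; exists t.
- by case=> -> ->; left.
- by case=> t tS ->; right; apply/imfsetP; exists t.
Qed.

Lemma restack_nonbranching F S v : 0 < d -> nonbranching d F -> S `<=` F -> stacked S ->
  {in F, forall f, v \notin f} -> nonbranching d (restack F S v).
Proof.
move=> d0 nbF SF stS vF t f g h td [/restackP fR /restackP gR /restackP hR] [tf tg th].
have vr r : r \in ridges S -> v \notin r.
  move=> /ridgesP[_ [k [kS rk _]]]; apply: contra (vF k (fsubsetP SF _ kS)).
  by move/(fsubsetP rk).
case: (boolP (v \in t)) => vt.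
  have cone_case k : (k \in F /\ k \notin S) \/ (exists2 r, r \in ridges S & k = v |` r) ->
      t `<=` k -> exists2 r, r \in ridges S & k = v |` r /\ t `\ v `<=` r.
    move=> [[kF _] /fsubsetP/(_ _ vt)|[r rS ->] tr]; first by rewrite (negPf (vF _ kF)).
    by exists r => //; rewrite fsubDset.
  have [r1 r1S [-> t1]] := cone_case _ fR tf; have [r2 r2S [-> t2]] := cone_case _ gR tg.
  have [r3 r3S [-> t3]] := cone_case _ hR th.
  have tv : #|` t `\ v| = d.-1 by have := cardfsD1 v t; rewrite vt td => ->.
  by case: (ridges_nonbranching d0 nbF SF stS tv (And3 r1S r2S r3S) (And3 t1 t2 t3)) => ->;
    [constructor 1|constructor 2|constructor 3].
have coneE r : r \in ridges S -> t `<=` v |` r -> r = t.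
  move=> rS tr; apply/esym/card_subset_eq; first exact: (@sub_base _ v).
  by rewrite td (card_ridge rS).
have two k l : k \in F -> k \notin S -> l \in F -> l \notin S -> t \in ridges S ->
    t `<=` k -> t `<=` l -> k = l.
  move=> kF kS lF lS /ridgesP[_ [s [sS ts _]]] tk tl.
  case: (nbF t k l s td) => //; first by split=> //; exact: (fsubsetP SF).
    by move=> E; rewrite E sS in lS.
  by move=> E; rewrite E sS in kS.
case: fR => [[fF fS]|[r1 r1S E1]]; case: gR => [[gF gS]|[r2 r2S E2]];
case: hR => [[hF hS]|[r3 r3S E3]]; subst;
repeat match goal with r : is_true (_ `<=` _ |` _) |- _ => apply coneE in r => // end; subst.
- exact: (nbF t).
- by constructor 1; apply: two.
- by constructor 3; apply: two.
- by constructor 2.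
- by constructor 2; apply: two.
- by constructor 3.
- by constructor 1.
- by constructor 1.
Qed.

Variable R : realType.

(* A stacked ball is swapped for the cone over its boundary by one bistellar
   flip per facet: the first inserts the apex [v], and the facet [w |` t] glued
   along [t] is then absorbed by trading [t * {v, w}] for [boundary t * vw]. *)
Lemma restack_homeomorphic F S v : 0 < d -> {in F, forall f, #|` f| = d.+1} ->
  nonbranching d F -> S `<=` F -> stacked S -> {in F, forall f, v \notin f} ->
  PL_homeomorphic R (generated F) (generated (restack F S v)).
Proof.
move=> d0 sizeF nbF SF stS vF; elim: stS SF => [s sd SF|{}S f t w stS IH fS tf td wS SF].
  have sF : s \in F by apply: (fsubsetP SF); rewrite fset11.
  have ridge a : a \in s -> s `\ a \in ridges [fset s].
    move=> as_; apply/ridgesP; split; first by have := cardfsD1 a s; rewrite as_ sd => -[].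
    by exists s; split; rewrite ?fset11 ?fsubD1set // => h /fset1P.
  have in_cone u a : a \in s -> u `<=` v |` (s `\ a) -> u \in generated (restack F [fset s] v).
    move=> as_ us; apply/generatedP; exists (v |` (s `\ a)) => //.
    by apply/restackP; right; exists (s `\ a) => //; exact: ridge.
  have sE u : u \in F -> s `<=` u -> s = u.
    by move=> uF su; apply: card_subset_eq; rewrite // sd sizeF.
  have vs := vF _ sF.
  have subs r : r \in ridges [fset s] -> r `<=` s by case/ridgesP => _ [k [/fset1P ->]].
  (* For a single facet the replacement is the stellar subdivision of that facet. *)
  apply: (@flip_homeomorphic R V _ _ s [fset v]).
  - by rewrite -cardfs_gt0 sd.
  - by rewrite -cardfs_gt0 cardfs1.
  - by rewrite fdisjoint_sym fdisjoint1X.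
  - by move=> ? ?; exact: generated_closed.
  - by move=> ? ?; exact: generated_closed.
  - move=> u /generatedP[g gF ug]; split.
    + by rewrite fsub1set; apply: contra (vF _ gF) => /(fsubsetP ug).
    + move=> /fsubsetPn[a as_ au]; have [E|gs] := eqVneq g s.
        apply: (in_cone _ a) => //; apply: fsubset_trans (fsubsetU1 _ _).
        by rewrite fsubsetD1 au -E ug.
      by apply/generatedP; exists g => //; apply/restackP; left; rewrite inE.
    + move=> su a as_; have E := sE _ gF (fsubset_trans su ug).
      apply: (in_cone _ a) => //; rewrite fsetUC fsetUS // fsetSD //.
      by rewrite E.
  - move=> u /generatedP[g /restackP[[gF gs]|[r rS ->]] ug].
      rewrite inE in gs; split.
      + by apply: contra gs => su; rewrite (sE _ gF (fsubset_trans su ug)).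
      + by move=> _; apply/generatedP; exists g.
      + rewrite fsub1set => /(fsubsetP ug); by rewrite (negPf (vF _ gF)).
    split.
    + apply/negP => su; have /fsubset_leq_card : s `<=` r.
        by apply: (@sub_base _ v) => //; exact: fsubset_trans su ug.
      by rewrite sd (card_ridge rS) ltnn.
    + rewrite fsub1set => vu; apply/generatedP; exists s => //.
      by apply: fsubset_trans (subs _ rS); exact: sub_base ug vu.
    + move=> _ a /fset1P ->; apply/generatedP; exists s => //.
      rewrite fsubUset fsubset_refl andbT; apply: fsubset_trans (subs _ rS).
      by rewrite fsubDset.
have SF' := fsubset_trans (fsubsetUr _ _) SF.
apply: PL_homeomorphic_trans (IH SF') _ => {IH}.
have sF : w |` t \in F by apply: (fsubsetP SF); rewrite fset1U1.
have tS := nonbranching_ridge nbF fS tf td wS SF.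
have wt := apex_notin_base fS tf wS.
have sS := extension_notin t wS.
have vs := vF _ sF; have vw : v != w by apply: contraNneq vs => ->; rewrite fset1U1.
have vt : v \notin t by apply: contra vs => vt; rewrite !inE vt orbT.
have inv := ridges_extension_inv fS tf td wS d0.
have in_cone u a : a \in t -> u `<=` v |` (w |` (t `\ a)) ->
    u \in generated (restack F (w |` t |` S) v).
  move=> at_ us; apply/generatedP; exists (v |` (w |` (t `\ a))) => //.
  by apply/restackP; right; exists (w |` (t `\ a)) => //; exact: (ridges_extension_new fS tf td wS).
have in_old u : u `<=` w |` t -> u \in generated (restack F S v).
  by move=> us; apply/generatedP; exists (w |` t) => //; apply/restackP; left.
have in_base u : u `<=` v |` t -> u \in generated (restack F S v).
  by move=> us; apply/generatedP; exists (v |` t) => //; apply/restackP; right; exists t.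
(* The facet [f] of [S] occupies the other place at [t]. *)
have sE g : g \in F -> g \notin S -> t `<=` g -> g = w |` t.
  move=> gF gS tg; have fF := fsubsetP SF' _ fS.
  case: (nbF t g (w |` t) f td) => //; first by split=> //; exact: fsubsetU1.
    by move=> E; rewrite E fS in sS.
  by move=> E; rewrite E fS in gS.
have rt r : r \in ridges S -> t `<=` r -> t = r.
  by move=> rS tr; apply: card_subset_eq; rewrite // td (card_ridge rS).
(* At this stage the facets through [t] are [w |] t[, not yet absorbed, and]v |[t], the cone over
   the ridge [t]; so the link of [t] is the boundary of the edge [{v, w}]. *)
apply: (@flip_homeomorphic R V _ _ t [fset v; w]).
- by rewrite -cardfs_gt0 td.
- by rewrite -cardfs_gt0 cardfs2 vw.
- by apply/fdisjointP_sym => x /fset2P[] ->.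
- by move=> ? ?; exact: generated_closed.
- by move=> ? ?; exact: generated_closed.
- move=> u /generatedP[g /restackP[[gF gS]|[r rS ->]] ug].
    split.
    + apply/negP => /fsubsetP/(_ v); rewrite !inE eqxx /= => /(_ isT)/(fsubsetP ug).
      by rewrite (negPf (vF _ gF)).
    + move=> /fsubsetPn[a at_ au]; have [E|gs] := eqVneq g (w |` t).
        apply: (in_cone _ a) => //; apply: fsubset_trans (fsubsetU1 _ _).
        apply/fsubsetP => x xu; have := fsubsetP ug _ xu; rewrite E !inE.
        by case/orP => [->//|->]; rewrite andbT (contraTneq _ xu) ?orbT // => ->.
      by apply/generatedP; exists g => //; apply/restackP; left; rewrite !inE negb_or gs.
    + move=> tu a at_; have E := sE _ gF gS (fsubset_trans tu ug).
      apply: (in_cone _ a) => //; rewrite E in ug.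
      apply/fsubsetP => x; rewrite !inE => /or3P[/andP[xa /(fsubsetP ug)]|->|->];
        rewrite ?orbT // !inE => /orP[] ->; by rewrite ?xa ?orbT.
  have wr := ridge_apex_notin wS rS; split.
  + apply/negP => /fsubsetP/(_ w); rewrite !inE eqxx orbT => /(_ isT)/(fsubsetP ug).
    by rewrite !inE eq_sym (negPf vw) (negPf wr).
  + move=> /fsubsetPn[a at_ au]; have [E|rt'] := eqVneq r t.
      apply: (in_cone _ a) => //; apply/fsubsetP => x xu; have := fsubsetP ug _ xu.
      rewrite E !inE => /orP[->//|->].
      by rewrite andbT (contraTneq _ xu) ?orbT // => ->.
    apply/generatedP; exists (v |` r) => //; apply/restackP; right; exists r => //.
    exact: ridges_extension_old.
  + move=> tu a at_; have E : t = r.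
      apply: rt => //; apply: (@sub_base _ v) => //; exact: fsubset_trans tu ug.
    apply: (in_cone _ a) => //; rewrite -E in ug.
    apply/fsubsetP => x; rewrite !inE => /or3P[/andP[xa /(fsubsetP ug)]|->|->];
        rewrite ?orbT // !inE => /orP[] ->; by rewrite ?xa ?orbT.
- move=> u /generatedP[g /restackP[[gF gS]|[r /inv rS ->]] ug].
    move: gS; rewrite !inE negb_or => /andP[gs gS]; split.
    + by apply: contra gs => tu; rewrite (sE g) ?(fsubset_trans tu).
    + by move=> _; apply/generatedP; exists g => //; apply/restackP; left.
    + move=> /fsubsetP/(_ v); rewrite !inE eqxx /= => /(_ isT)/(fsubsetP ug).
      by rewrite (negPf (vF _ gF)).
  case: rS => [[rS rt']|[a at_ E]].
    split.
    + apply/negP => tu; case/eqP: rt'; apply/esym/rt => //.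
      by apply: (@sub_base _ v) => //; exact: fsubset_trans tu ug.
    + by move=> _; apply/generatedP; exists (v |` r) => //; apply/restackP; right; exists r.
    + move=> /fsubsetP/(_ w); rewrite !inE eqxx orbT => /(_ isT)/(fsubsetP ug).
      by rewrite !inE eq_sym (negPf vw) (negPf (ridge_apex_notin wS rS)).
  rewrite {}E in ug; split.
  + apply/negP => /fsubsetP/(_ _ at_)/(fsubsetP ug); rewrite !inE eqxx /= orbF.
    by case/orP => /eqP E; [move: vt|move: wt]; rewrite -E at_.
  + move=> /fsubsetPn[x /fset2P[] -> xu].
      apply: in_old; apply/fsubsetP => y yu; have := fsubsetP ug _ yu; rewrite !inE.
      by case/or3P => [/eqP E|->//|/andP[_ ->]]; [rewrite -E yu in xu|rewrite orbT].
    apply: in_base; apply/fsubsetP => y yu; have := fsubsetP ug _ yu; rewrite !inE.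
    by case/or3P => [->//|/eqP E|/andP[_ ->]]; [rewrite -E yu in xu|rewrite orbT].
  + move=> _ x /fset2P[] ->.
      apply: in_old; apply/fsubsetP => y; rewrite !inE => /orP[/andP[yv /(fsubsetP ug)]|->];
        rewrite ?orbT // !inE (negPf yv) /=.
      by case/orP => [->//|/andP[_ ->]]; rewrite orbT.
    apply: in_base; apply/fsubsetP => y; rewrite !inE => /orP[/andP[yv /(fsubsetP ug)]|->];
      rewrite ?orbT // !inE (negPf yv) /=.
    by case/orP => [->//|/andP[_ ->]]; rewrite orbT.
Qed.

End Stacked.

(** * Centrally symmetric replacement *)

Section SignedRestack.
Local Open Scope ring_scope.
Implicit Types (F S : {fset {fset int}}) (s t f g e : {fset int}) (v w : int).

Lemma in_Vset m v : (v \in Vset m) = (v != 0) && (`|v| <= m)%N.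
Proof.
rewrite inE; apply/orP/andP => [[]/imfsetP[k /=]|[v0 vm]].
- by rewrite mem_iota => k1 ->; split; lia.
- by rewrite mem_iota => k1 ->; split; lia.
case: (lerP 0 v) => v1; [left|right]; apply/imfsetP; exists `|v|%N => //=;
by rewrite ?mem_iota; lia.
Qed.

Lemma in_VsetN m v : (- v \in Vset m) = (v \in Vset m).
Proof. by rewrite !in_Vset oppr_eq0 abszN. Qed.

Lemma neg_faceU1 v t : neg_face (v |` t) = - v |` neg_face t.
Proof. exact: imfsetU1. Qed.

Lemma neg_ridges d S : ridges d (neg S) = neg (ridges d S).
Proof.
apply/fsetP => t; rewrite in_neg; apply/ridgesP/ridgesP => -[td [f [fS tf uf]]];
rewrite ?card_neg_face in td *; split=> //; exists (neg_face f); rewrite ?in_neg ?neg_faceK in fS *;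
split=> //.
- by rewrite neg_faceS.
- move=> g gS tg; rewrite -(uf (neg_face g)) ?neg_faceK ?in_neg ?neg_faceK //.
  by rewrite -neg_faceS neg_faceK.
- by rewrite -neg_faceS neg_faceK.
- move=> g gS tg; rewrite -(uf (neg_face g)) ?neg_faceK -?in_neg //.
  by rewrite neg_faceS.
Qed.

Lemma stacked_neg d S : stacked d S -> stacked d (neg S).
Proof.
elim=> [s sd|{}S f t w stS IH fS tf td wS].
  have -> : neg [fset s] = [fset neg_face s].
    by apply/fsetP => t; rewrite in_neg !inE -(inj_eq (can_inj neg_faceK)) neg_faceK.
  by apply: stacked1; rewrite card_neg_face.
have -> : neg ((w |` t) |` S) = (- w |` neg_face t) |` neg S.
  apply/fsetP => s; rewrite in_neg !inE in_neg -neg_faceU1.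
  by rewrite -(inj_eq (can_inj neg_faceK)) neg_faceK.
apply: (stackedU (f := neg_face f)) => //.
- by rewrite in_neg neg_faceK.
- by rewrite neg_faceS.
- by rewrite card_neg_face.
- move=> g; rewrite in_neg => /wS; by rewrite in_neg_face.
Qed.

(** The invariant of the whole induction, stated for the facets. It keeps the combinatorial data
    that the next replacement consumes next to the homeomorphism itself. *)
Record cs2_sphere (R : realType) (n : nat) F : Prop := CS2Sphere {
  sphere_size : {in F, forall f, #|` f| = 4};
  sphere_sub : {in F, forall f, f `<=` Vset n};
  sphere_nb : nonbranching 3 F;
  sphere_neg : {in F, forall f, neg_face f \in F};
  sphere_PL : PL_homeomorphic R (generated F) (simplex_boundary 3);
  sphere_edges : cs_neighborly 2 n (generated F) }.

Definition cs_restack F S v := restack 3 (restack 3 F S v) (neg S) (- v).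

Section Step.
Variables (R : realType) (n : nat) (F S : {fset {fset int}}).
Hypotheses (n0 : (0 < n)%N) (goodF : cs2_sphere R n F) (stS : stacked 3 S) (SF : S `<=` F)
  (SN : {in S, forall s, neg_face s \notin S})
  (cov : forall v, v \in Vset n -> exists2 s, s \in S & v \in s).

Let v := n.+1%:Z.

Lemma sphere_apex : {in F, forall f, v \notin f}.
Proof.
move=> f fF; apply/negP => /(fsubsetP (sphere_sub goodF fF)).
by rewrite in_Vset /v; lia.
Qed.

Lemma sphere_apexN : {in F, forall f, - v \notin f}.
Proof.
move=> f fF; apply/negP => /(fsubsetP (sphere_sub goodF fF)).
by rewrite in_Vset /v; lia.
Qed.

Lemma neg_subF : neg S `<=` F.
Proof.
apply/fsubsetP => s; rewrite in_neg => /(fsubsetP SF)/(sphere_neg goodF).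
by rewrite neg_faceK.
Qed.

Lemma in_negS_notin s : s \in neg S -> s \notin S.
Proof. by rewrite in_neg => /SN; rewrite neg_faceK. Qed.

(** The two replacements are carried out one after the other, and the second is possible because the
    first removes no facet of [neg S]. *)
Lemma neg_sub_restack : neg S `<=` restack 3 F S v.
Proof.
apply/fsubsetP => s sS; apply/restackP; left; split; first exact: (fsubsetP neg_subF).
exact: in_negS_notin.
Qed.

Lemma ridge_sub t : t \in ridges 3 S -> t `<=` Vset n.
Proof.
move=> /ridgesP[_ [f [fS tf _]]]; apply: fsubset_trans tf _.
exact: (sphere_sub goodF (fsubsetP SF _ fS)).
Qed.

Lemma restack_apexN : {in restack 3 F S v, forall f, - v \notin f}.
Proof.
move=> f /restackP[[fF _]|[t /ridge_sub /fsubsetP tS ->]]; first exact: sphere_apexN.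
by apply/negP; rewrite !inE => /orP[/eqP|/tS]; rewrite ?in_Vset /v; lia.
Qed.

Lemma cs_restackP g : reflect
  [\/ [/\ g \in F, g \notin S & neg_face g \notin S],
      exists2 t, t \in ridges 3 S & g = v |` t
    | exists2 t, t \in ridges 3 S & g = neg_face (v |` t)] (g \in cs_restack F S v).
Proof.
apply: (iffP (restackP _ _ _ _ _)) => [[[/restackP[[gF gS]|]]|]|].
- by rewrite in_neg; constructor 1.
- by constructor 2.
- rewrite neg_ridges => -[t]; rewrite in_neg => tS ->; constructor 3.
  by exists (neg_face t); rewrite // neg_faceU1 neg_faceK.
case=> [[gF gS gN]|[t tS ->]|[t tS ->]].
- by left; rewrite in_neg; split => //; apply/restackP; left.
- left; split; first by apply/restackP; right; exists t.
  apply/negP => /(fsubsetP neg_subF)/sphere_apex; by rewrite fset1U1.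
- right; exists (neg_face t); last by rewrite neg_faceU1.
  by rewrite neg_ridges in_neg neg_faceK.
Qed.

Lemma cs_restack_neg : {in cs_restack F S v, forall f, neg_face f \in cs_restack F S v}.
Proof.
move=> f /cs_restackP[[fF fS fN]|[t tS ->]|[t tS ->]]; apply/cs_restackP.
- by constructor 1; split; rewrite ?neg_faceK // (sphere_neg goodF).
- by constructor 3; exists t.
- by constructor 2; exists t; rewrite ?neg_faceK.
Qed.

Lemma cs_restack_edges : cs_neighborly 2 n.+1 (generated (cs_restack F S v)).
Proof.
have VE w : w \in Vset n.+1 -> [|| w == v, w == - v | w \in Vset n].
  by rewrite !in_Vset /v; lia.
have apex e : v \in e -> e `<=` Vset n.+1 -> (#|` e| <= 2)%N -> antipode_free e ->
    e \in generated (cs_restack F S v).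
  move=> ve eV e2 /allP ea; have : exists2 s, s \in S & e `\ v `<=` s.
    have e1 : (#|` e `\ v| <= 1)%N by have := cardfsD1 v e; rewrite ve; lia.
    have [e0|/fset0Pn[w wE]] := eqVneq (e `\ v) fset0.
      (* Here [e] is the apex alone and any facet of [S] will do; the vertex 1 merely shows that
         there is one. *)
      have [|s sS _] := cov (v := 1); first by rewrite in_Vset; lia.
      by exists s; rewrite // e0 fsub0set.
    have ew : e `\ v = [fset w].
      by apply/esym/card_subset_eq; rewrite ?fsub1set // cardfs1.
    rewrite ew; move: wE; rewrite !inE => /andP[wv we].
    have [|s sS ws] := cov (v := w); last by exists s; rewrite // fsub1set.
    (* The other end of the edge is not [- v], since [e] contains no antipodal pair; so it is an old
       vertex and [S] covers it. *)
    have := VE _ (fsubsetP eV _ we); rewrite (negPf wv) /= => /orP[/eqP wN|//].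
    by have := ea _ ve; rewrite -wN we.
  move=> [s sS es]; have [||r rS er] := stacked_coridge _ stS sS es => //.
    by have := cardfsD1 v e; rewrite ve; lia.
  apply/generatedP; exists (v |` r); last by rewrite -fsubDset.
  by apply/cs_restackP; constructor 2; exists r.
move=> e eV e2 ea; have [ve|ve] := boolP (v \in e); first exact: apex.
have [vNe|vNe] := boolP (- v \in e).
  have : neg_face e \in generated (cs_restack F S v).
    apply: apex; rewrite ?in_neg_face ?card_neg_face //.
      apply/fsubsetP => w; rewrite in_neg_face => /(fsubsetP eV); by rewrite in_VsetN.
    apply/allP => w; rewrite !in_neg_face => /(allP ea); by rewrite opprK.
  case/generatedP => f fR ef; apply/generatedP; exists (neg_face f).
    exact: cs_restack_neg.
  by rewrite -neg_faceS neg_faceK.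
have {}eV : e `<=` Vset n.
  apply/fsubsetP => w we; case/or3P: (VE _ (fsubsetP eV _ we)) => // /eqP wv.
    by rewrite -wv we in ve.
  by rewrite -wv we in vNe.
have /generatedP[f fF ef] := sphere_edges goodF eV e2 ea.
(* Fewer than three vertices means codimension at least two, so [stacked_coridge] keeps [e] on the
   boundary of whichever ball swallowed its facet. *)
have e3 : (#|` e| < 3)%N by [].
have [fS|fS] := boolP (f \in S).
  have [r rS er] := @stacked_coridge _ 3 _ _ _ isT stS fS ef e3.
  apply/generatedP; exists (v |` r); last exact: fsubset_trans er (fsubsetU1 _ _).
  by apply/cs_restackP; constructor 2; exists r.
have [fN|fN] := boolP (neg_face f \in S).
  have efN : neg_face e `<=` neg_face f by rewrite neg_faceS.
  rewrite -card_neg_face in e3.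
  have [r rS er] := @stacked_coridge _ 3 _ _ _ isT stS fN efN e3.
  apply/generatedP; exists (neg_face (v |` r)).
    by apply/cs_restackP; constructor 3; exists r.
  by rewrite -neg_faceS neg_faceK; exact: fsubset_trans er (fsubsetU1 _ _).
by apply/generatedP; exists f => //; apply/cs_restackP; constructor 1.
Qed.

Lemma cs_restack_sphere : cs2_sphere R n.+1 (cs_restack F S v).
Proof.
have sV : Vset n `<=` Vset n.+1 by apply/fsubsetP => w; rewrite !in_Vset; lia.
have szR : {in restack 3 F S v, forall f, #|` f| = 4}.
  move=> f /restackP[[fF _]|[t tS ->]]; first exact: (sphere_size goodF).
  rewrite cardfsU1 (card_ridge tS); case: (boolP (v \in t)) => //= /(fsubsetP (ridge_sub tS)).
  by rewrite in_Vset /v; lia.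
have nbR : nonbranching 3 (restack 3 F S v).
  exact: (@restack_nonbranching _ 3 _ _ _ isT (sphere_nb goodF) SF stS sphere_apex).
split.
- move=> f /cs_restackP[[fF _ _]|[t tS ->]|[t tS ->]].
  + exact: (sphere_size goodF).
  + by apply: szR; apply/restackP; right; exists t.
  + by rewrite card_neg_face; apply: szR; apply/restackP; right; exists t.
- have tV t : t \in ridges 3 S -> v |` t `<=` Vset n.+1.
    move=> /ridge_sub tS; rewrite fsubUset (fsubset_trans tS sV) andbT fsub1set.
    by rewrite in_Vset /v; lia.
  move=> f /cs_restackP[[fF _ _]|[t tS ->]|[t tS ->]].
  + exact: fsubset_trans (sphere_sub goodF fF) sV.
  + exact: tV.
  + apply/fsubsetP => w; rewrite in_neg_face => /(fsubsetP (tV _ tS)).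
    by rewrite in_VsetN.
- exact: (@restack_nonbranching _ 3 _ _ _ isT nbR neg_sub_restack (stacked_neg stS) restack_apexN).
- exact: cs_restack_neg.
- apply: PL_homeomorphic_trans (sphere_PL goodF).
  apply: PL_homeomorphic_trans (PL_homeomorphic_sym
    (@restack_homeomorphic _ 3 R _ _ _ isT (sphere_size goodF) (sphere_nb goodF) SF stS sphere_apex)).
  apply: PL_homeomorphic_sym.
  exact: (@restack_homeomorphic _ 3 R _ _ _ isT szR nbR neg_sub_restack (stacked_neg stS) restack_apexN).
- exact: cs_restack_edges.
Qed.

(** The definition of [cs_replace] tests membership in the complexes, [cs_restack] in the sets of
    facets. For facets of [F] the tests agree, all cardinalities being 4. *)
Lemma cs_replace_generated :
  cs_replace 3 (generated F) (generated S) v = generated (cs_restack F S v).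
Proof.
have szF := sphere_size goodF.
have szS : {in S, forall s, #|` s| = 4} by move=> s /(fsubsetP SF)/szF.
have inS f : f \in F -> (f \in generated S) = (f \in S).
  move=> fF; apply/generatedP/idP => [[g gS fg]|fS]; last by exists f.
  by rewrite (card_subset_eq fg) // (szS g gS) szF.
rewrite /cs_replace neg_generated !boundary_generated //; last exact: stacked_size (stacked_neg stS).
rewrite !cone_generated !generatedU; congr generated; apply/fsetP => g.
rewrite neg_ridges (facets_generated szF); apply/idP/cs_restackP; rewrite !in_fsetU.
  case/orP => [/orP[|/imfsetP[t /= tS ->]]|/imfsetP[t /=]].
  - rewrite !inE /= => /and3P[gF gS gN]; constructor 1; rewrite inS // in gS; split => //.
    by rewrite -inS ?(sphere_neg goodF) // -in_neg neg_generated.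
  - by constructor 2; exists t.
  - rewrite in_neg => tS ->; constructor 3.
    by exists (neg_face t); rewrite // neg_faceU1 neg_faceK.
case=> [[gF gS gN]|[t tS ->]|[t tS ->]].
- by rewrite !inE /= gF inS // gS -neg_generated in_neg inS ?(sphere_neg goodF) // gN.
- by apply/orP; left; apply/orP; right; apply/imfsetP; exists t.
- apply/orP; right; apply/imfsetP; exists (neg_face t); rewrite ?neg_faceU1 //=.
  by rewrite in_neg neg_faceK.
Qed.

End Step.
End SignedRestack.

(** * The cross-polytope *)

Section Crosspolytope.
Local Open Scope ring_scope.
Implicit Types (s t f g h : {fset int}) (v : int).

Definition crosspolytope_facets m : {fset {fset int}} :=
  [fset s in crosspolytope_boundary m | #|` s| == m].

Lemma in_crosspolytope m s :
  (s \in crosspolytope_boundary m) = (s `<=` Vset m) && antipode_free s.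
Proof. by rewrite !inE /= fpowersetE. Qed.

Lemma crosspolytope_facetsP m f : reflect
  [/\ f `<=` Vset m, antipode_free f & #|` f| = m] (f \in crosspolytope_facets m).
Proof.
rewrite !inE /= fpowersetE -andbA.
by apply: (iffP and3P) => -[fV fa fm]; split => //; apply/eqP.
Qed.

Lemma antipode_freeS s t : t `<=` s -> antipode_free s -> antipode_free t.
Proof.
move=> /fsubsetP ts /allP sa; apply/allP => v vt; apply: contra (sa v (ts _ vt)); exact: ts.
Qed.

Lemma card_iota_imfset (h : nat -> int) m : injective h -> #|` [fset h k | k in iota 1 m]| = m.
Proof.
move=> hi; rewrite card_imfset //= -[RHS](size_iota 1); congr size.
by rewrite -[RHS]undup_id ?iota_uniq.
Qed.

Lemma card_Vset m : #|` Vset m| = (m + m)%N.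
Proof.
rewrite /Vset cardfsU !card_iota_imfset; try by move=> a b; lia.
rewrite (_ : _ `&` _ = fset0) ?cardfs0 ?subn0 //; apply/fsetP => x; rewrite !inE.
apply/negP => /andP[/imfsetP[a /=]]; rewrite mem_iota => a1 -> /imfsetP[b /=].
by rewrite mem_iota => b1; lia.
Qed.

Lemma crosspolytope_generated m :
  crosspolytope_boundary m = generated (crosspolytope_facets m).
Proof.
apply/fsetP => s; rewrite in_crosspolytope; apply/andP/generatedP => [[sV sa]|]; last first.
  by case=> f /crosspolytope_facetsP[fV fa _] sf; split; [exact: fsubset_trans fV|exact: antipode_freeS fa].
(* Extends [s] to a facet by one sign per index; choosing the negative sign by default also retains
   the negative vertices of [s]. *)
pose h k : int := if k%:Z \in s then k%:Z else - k%:Z.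
have habs k : `|h k|%N = k by rewrite /h; case: ifP => _; lia.
have hi : injective h by move=> a b E; rewrite -(habs a) -(habs b) E.
exists [fset h k | k in iota 1 m].
  apply/crosspolytope_facetsP; split; last exact: card_iota_imfset.
    apply/fsubsetP => x /imfsetP[k /=]; rewrite mem_iota => k1 ->.
    rewrite in_Vset habs; have := habs k; lia.
  apply/allP => x /imfsetP[k /=]; rewrite mem_iota => k1 ->.
  apply/negP => /imfsetP[j /=]; rewrite mem_iota => j1 E.
  have jk : j = k by rewrite -(habs j) -E abszN habs.
  by have := habs k; move: E; rewrite jk; lia.
apply/fsubsetP => x xs; apply/imfsetP; exists `|x|%N.
  by have := fsubsetP sV _ xs; rewrite in_Vset /= mem_iota; lia.
rewrite /h; case: (lerP 0 x) => x0; first by rewrite gez0_abs // xs.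
rewrite ltz0_abs // opprK ifN //; exact: (allP sa).
Qed.

(** A facet through [t] avoids the antipodes of [t], so it is confined to $2m-(m-1)=|t|+2$
    vertices. *)
Lemma crosspolytope_nonbranching m : (0 < m)%N -> nonbranching m.-1 (crosspolytope_facets m).
Proof.
move=> m0 t f g h tm [fF gF hF] [tf tg th].
have sub k : k \in crosspolytope_facets m -> t `<=` k ->
    k `<=` Vset m `\` neg_face t /\ #|` k| = #|` t|.+1.
  move=> /crosspolytope_facetsP[kV /allP ka km] tk; split; last by rewrite km tm prednK.
  apply/fsubsetP => v vk; rewrite inE (fsubsetP kV) // andbT in_neg_face.
  by apply: contra (ka _ vk); exact: (fsubsetP tk).
have [fs fc] := sub _ fF tf; have [gs gc] := sub _ gF tg; have [hs hc] := sub _ hF th.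
apply: (@subset_corank2 _ t (Vset m `\` neg_face t)) => //.
rewrite cardfsDS ?card_neg_face ?card_Vset ?tm; first lia.
apply/fsubsetP => v; rewrite in_neg_face => /(fsubsetP tf).
by case/crosspolytope_facetsP: fF => /fsubsetP fV _ _ /fV; rewrite in_VsetN.
Qed.

Variable R : realType.

Lemma in_fpowerset_sep (V : choiceType) (U s : {fset V}) (P : pred {fset V}) :
  (s \in [fset s in fpowerset U | P s]) = (s `<=` U) && P s.
Proof. by rewrite !inE /= fpowersetE. Qed.

(* Stellar subdivision at the simplex [X], with new vertex [b]: a missing face
   [a |` X] is traded for the missing faces [X] and [{a, b}]. *)
Lemma stellar_homeomorphic (V : choiceType) (U X : {fset V}) (a b : V) (Q : pred {fset V}) :
  a \notin X -> b \notin U -> a \in U -> X `<=` U -> X != fset0 ->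
  (forall s t : {fset V}, Q s -> t `<=` s -> Q t) -> (forall s : {fset V}, Q s -> Q (s `|` ([fset a; b] `|` X))) ->
  PL_homeomorphic R [fset s in fpowerset U | ~~ (a |` X `<=` s) && Q s]
    [fset s in fpowerset (b |` U) | ~~ (X `<=` s) && (~~ ([fset a; b] `<=` s) && Q s)].
Proof.
move=> aX bU aU XU X0 Qs QU.
have bX : b \notin X by apply: contra bU; exact: (fsubsetP XU).
have ab : a != b by apply: contraNneq bU => <-.
apply: (@flip_homeomorphic R V _ _ X [fset b]) => //.
- by apply/fset0Pn; exists b; rewrite fset11.
- by rewrite fdisjoint_sym fdisjoint1X.
- move=> s t; rewrite !in_fpowerset_sep => /and3P[sU aXs Qs'] ts.
  rewrite (fsubset_trans ts sU) (Qs _ _ Qs' ts) andbT /=.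
  by apply: contra aXs => /fsubset_trans; exact.
- move=> s t; rewrite !in_fpowerset_sep => /and4P[sU aXs abs Qs'] ts.
  rewrite (fsubset_trans ts sU) (Qs _ _ Qs' ts) andbT /=; apply/andP; split.
    by apply: contra aXs => /fsubset_trans; exact.
  by apply: contra abs => /fsubset_trans; exact.
- move=> s; rewrite in_fpowerset_sep => /and3P[sU aXs Qs'].
  have bs : b \notin s by apply: contra bU; exact: (fsubsetP sU).
  split; first by rewrite fsub1set.
    move=> Xs; rewrite in_fpowerset_sep Xs Qs' andbT (fsubset_trans sU) ?fsubsetU1 //=.
    by apply: contra bs => /fsubsetP; apply; rewrite !inE eqxx orbT.
  move=> Xs x xX; have as_ : a \notin s.
    by apply: contra aXs => as_; rewrite fsubUset Xs fsub1set as_.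
  rewrite in_fpowerset_sep; apply/and4P; split.
  + apply/fsubsetP => y; rewrite !inE => /orP[/andP[_ /(fsubsetP sU) ->]|->//]; exact: orbT.
  + apply/negP => /fsubsetP/(_ _ xX); rewrite !inE eqxx /= => /eqP xb.
    by rewrite -xb xX in bX.
  + apply/negP => /fsubsetP/(_ a); rewrite !inE eqxx /= (negPf as_) (negPf ab) andbF.
    by move=> /(_ isT).
  + apply: Qs (QU _ Qs') _; apply/fsubsetP => y; rewrite !inE.
    by case/orP => [/andP[_ ->//]|->]; rewrite ?orbT.
- move=> s; rewrite in_fpowerset_sep => /and4P[sU Xs abs Qs']; split => //.
    rewrite fsub1set => bs; rewrite in_fpowerset_sep Qs' andbT; apply/andP; split.
      apply/fsubsetP => y ys; have := fsubsetP sU _ ys; rewrite !inE => /orP[/eqP yb|//].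
      by rewrite -yb ys in bs.
    by apply: contra Xs; apply: fsubset_trans; exact: fsubsetU1.
  rewrite fsub1set => bs x /fset1P ->.
  have as_ : a \notin s.
    by apply: contra abs => as_; rewrite fsubUset !fsub1set as_.
  rewrite in_fpowerset_sep; apply/and3P; split.
  + rewrite fsubUset XU andbT; by rewrite fsubDset.
  + apply/negP => /fsubsetP/(_ a); rewrite !inE eqxx (negPf as_) (negPf aX) andbF.
    by move=> /(_ isT).
  + apply: Qs (QU _ Qs') _; apply/fsubsetP => y; rewrite !inE.
    by case/orP => [/andP[_ ->//]|->]; rewrite ?orbT.
Qed.

Lemma pair_not_in_union (s : {fset int}) (p q : int) (T : {fset int}) :
  p \notin T -> q \notin T -> ~~ ([fset p; q] `<=` s) -> ~~ ([fset p; q] `<=` s `|` T).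
Proof.
move=> pT qT; apply: contra => /fsubsetP H; apply/fsubsetP => x xpq.
have := H x xpq; rewrite inE => /orP[//|xT].
by move: xpq; rewrite !inE => /orP[] /eqP E; [move: pT|move: qT]; rewrite -E xT.
Qed.

(** The names -1, 1, 2, 3, 4 leave just -4, -3, -2 to be introduced by subdivisions. The missing
    face and the trailing [true] are spelled in the form that [stellar_homeomorphic] expects. *)
Lemma simplex_boundary_int : PL_homeomorphic R (simplex_boundary 3)
  [fset s in fpowerset [fset -1; 1; 2; 3; 4 : int] |
    ~~ (4 |` [fset -1; 1; 2; 3] `<=` s) && true].
Proof.
pose h (i : 'I_5) : int := if (i : nat) == 0%N then -1 else (i : nat)%:Z.
pose h' (v : int) : 'I_5 := inord (if v == -1 then 0 else `|v|%N).
have hK : cancel h h'.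
  move=> i; have i5 := ltn_ord i; apply: val_inj; rewrite /h' /= inordK /h;
    by have [i0|i0] := eqVneq (i : nat) 0%N => //=; case: eqP => //=; lia.
have h'K v : v \in [fset -1; 1; 2; 3; 4 : int] -> h (h' v) = v.
  rewrite !inE -!orbA => vE; have E : val (h' v) = (if v == -1 then 0%N else `|v|%N).
    by rewrite /h' /= inordK //; case: ifP; lia.
  by rewrite /h E; move: vE; case: (eqVneq v (-1)) => [->|] //=; case: ifP; lia.
have U4 : [fset -1; 1; 2; 3; 4 : int] = 4 |` [fset -1; 1; 2; 3].
  by apply/fsetP => x; rewrite !inE orbC.
have full i : i \in [fset j | j : 'I_5] by rewrite in_imfset.
have hU i : h i \in [fset -1; 1; 2; 3; 4 : int].
  have := ltn_ord i; rewrite !inE /h; case: ifP => /=; lia.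
apply: (@relabel_homeomorphic R _ _ h h') => //.
- move=> s w; rewrite !inE /= fpowersetE => /andP[sU _] ws; apply: h'K.
  exact: (fsubsetP sU).
- move=> s; rewrite !inE /= !fpowersetE andbT -U4 => /andP[_ sN]; apply/andP; split.
    by apply/fsubsetP => _ /imfsetP[i _ ->]; exact: hU.
  apply: contra sN => /fsubsetP hs; apply/eqP/fsetP => i; rewrite full.
  have /imfsetP[j /= js E] := hs _ (hU i).
  by rewrite -(hK i) E hK js.
- move=> t; rewrite !inE /= !fpowersetE andbT -U4 => /andP[tU tN]; apply/andP; split.
    by apply/fsubsetP => i _; exact: full.
  apply: contra tN => /eqP tE; apply/fsubsetP => v vU.
  have := full (h' v); rewrite -tE => /imfsetP[w /= wt E].
  by rewrite -(h'K v vU) E (h'K w) // (fsubsetP tU).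
Qed.

(** The minimal non-faces evolve as follows. From $\{4,3,2,1,-1\}$, introducing -4 leaves
    $\{3,2,1,-1\}$ and $\{4,-4\}$; introducing -3 then splits $\{3,2,1,-1\}$ into $\{2,1,-1\}$ and
    $\{3,-3\}$; introducing -2 splits $\{2,1,-1\}$ into $\{1,-1\}$ and $\{2,-2\}$. What remains
    missing is exactly the four antipodal pairs. *)
Lemma crosspolytope_PL :
  PL_homeomorphic R (crosspolytope_boundary 4) (simplex_boundary 3).
Proof.
apply: PL_homeomorphic_sym; apply: PL_homeomorphic_trans simplex_boundary_int _.
apply: PL_homeomorphic_trans (@stellar_homeomorphic _ _ _ (4 : int) (-4 : int) _ _ _ _ _ _ _ _) _;
  rewrite ?inE //.
- by apply/fsubsetP => x; rewrite !inE => ->.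
- by apply/fset0Pn; exists 1; rewrite !inE.
set Q4 := fun s => ~~ ([fset 4; -4] `<=` s) && true.
have Q4s s t : Q4 s -> t `<=` s -> Q4 t.
  by rewrite /Q4 !andbT => H ts; apply: contra H => /fsubset_trans; exact.
rewrite (_ : [fset -1; 1; 2; 3 : int] = 3 |` [fset -1; 1; 2]); last first.
  by apply/fsetP => x; rewrite !inE orbC.
apply: PL_homeomorphic_trans (@stellar_homeomorphic _ _ _ (3 : int) (-3 : int) Q4 _ _ _ _ _ _ _) _;
  rewrite ?inE //.
- by apply/fsubsetP => x; rewrite !inE; lia.
- by apply/fset0Pn; exists 1; rewrite !inE.
- by move=> s; rewrite /Q4 !andbT; apply: pair_not_in_union; rewrite !inE.
set Q3 := fun s => ~~ ([fset 3; -3] `<=` s) && Q4 s.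
have Q3s s t : Q3 s -> t `<=` s -> Q3 t.
  rewrite /Q3 => /andP[H H4] ts; rewrite (Q4s s) // andbT.
  by apply: contra H => /fsubset_trans; exact.
rewrite (_ : [fset -1; 1; 2 : int] = 2 |` [fset -1; 1]); last first.
  by apply/fsetP => x; rewrite !inE orbC.
apply: PL_homeomorphic_trans (@stellar_homeomorphic _ _ _ (2 : int) (-2 : int) Q3 _ _ _ _ _ _ _) _;
  rewrite ?inE //.
- by apply/fsubsetP => x; rewrite !inE; lia.
- by apply/fset0Pn; exists 1; rewrite !inE.
- move=> s; rewrite /Q3 /Q4 !andbT => /andP[H3 H4]; apply/andP; split;
  by apply: pair_not_in_union; rewrite ?inE.
rewrite [X in PL_homeomorphic _ X _](_ : _ = crosspolytope_boundary 4).
  exact: PL_homeomorphic_refl.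
apply/fsetP => s; rewrite in_fpowerset_sep in_crosspolytope.
have -> : -2 |` (-3 |` (-4 |` (3 |` (2 |` [fset -1; 1]) `|` [fset 4]))) = Vset 4.
  by apply/fsetP => x; rewrite in_Vset !inE; lia.
case: (boolP (s `<=` Vset 4)) => //= /fsubsetP sV; rewrite /Q3 /Q4 andbT.
have pairE (p q : int) : ([fset p; q] `<=` s) = (p \in s) && (q \in s).
  by rewrite fsubUset !fsub1set.
rewrite !pairE; apply/idP/allP => [sN v vs|sa]; last first.
  have sa' (p q : int) : q = - p -> ~~ ((p \in s) && (q \in s)).
    by move=> ->; apply/negP => /andP[/sa/negPf ->].
  by rewrite !sa'.
apply/negP => vNs; have := sV _ vs; rewrite in_Vset => v4.
have : [|| v == 1, v == -1, v == 2, v == -2, v == 3, v == -3, v == 4 | v == -4] by lia.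
by do ?case/orP => [/eqP vE|]; last move=> /eqP vE; move: vs vNs sN; rewrite vE ?opprK => -> ->;
  rewrite ?andbF.
Qed.

End Crosspolytope.

Lemma crosspolytope_sphere (R : realType) : cs2_sphere R 4 (crosspolytope_facets 4).
Proof.
split.
- by move=> f /crosspolytope_facetsP[].
- by move=> f /crosspolytope_facetsP[].
- exact: (@crosspolytope_nonbranching 4).
- move=> f /crosspolytope_facetsP[/fsubsetP fV /allP fa fc].
  apply/crosspolytope_facetsP; split; last by rewrite card_neg_face.
    by apply/fsubsetP => v; rewrite in_neg_face => /fV; rewrite in_VsetN.
  by apply/allP => v; rewrite !in_neg_face => /fa.
- by rewrite -crosspolytope_generated; exact: crosspolytope_PL.
- move=> s sV _ sa; rewrite -crosspolytope_generated in_crosspolytope sV; exact: sa.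
Qed.

(** * The balls B^{3,1}_n and the spheres Delta^3_n *)

Section SignedSpheres.
Local Open Scope ring_scope.
Implicit Types (F S : {fset {fset int}}) (s t f g e : {fset int}) (a b c x v w : int).

Lemma in_quad x a b c (d : int) :
  (x \in [fset a; b; c; d]) = [|| x == a, x == b, x == c | x == d].
Proof. by rewrite !inE -!orbA. Qed.

Lemma sub_triple a b c f : ([fset a; b; c] `<=` f) = [&& a \in f, b \in f & c \in f].
Proof. by rewrite !fsubUset !fsub1set -andbA. Qed.

Lemma sub_quad a b c (d : int) f :
  ([fset a; b; c; d] `<=` f) = [&& a \in f, b \in f, c \in f & d \in f].
Proof. by rewrite !fsubUset !fsub1set -!andbA. Qed.

Lemma card_triple a b c : uniq [:: a; b; c] -> #|` [fset a; b; c]| = 3.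
Proof.
rewrite /= !inE !andbT negb_or => /andP[/andP[ab ac] bc].
by rewrite fsetUC cardfsU1 cardfs2 !inE negb_or ab eq_sym ac eq_sym bc.
Qed.

Lemma quad_rotate a b c (d : int) : [fset a; b; c; d] = a |` [fset b; c; d].
Proof. by apply/fsetP => x; rewrite !inE -!orbA. Qed.

Lemma card_quad a b c (d : int) : uniq [:: a; b; c; d] -> #|` [fset a; b; c; d]| = 4.
Proof.
move=> /andP[abcd ubcd]; rewrite quad_rotate cardfsU1 card_triple // !inE.
by move: abcd; rewrite !inE orbA => ->.
Qed.

Lemma neg_quad a b c (d : int) : neg_face [fset a; b; c; d] = [fset - a; - b; - c; - d].
Proof. by rewrite /neg_face !imfsetU !imfset_fset1. Qed.

(** Stating the facets through a predicate keeps the index ranges as integer inequalities, without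
    an explicit finite set for each family. *)
Definition stack_of (P : {fset int} -> Prop) : Prop :=
  exists2 S, stacked 3 S & forall f, f \in S <-> P f.

Lemma stack_of_ext (P Q : {fset int} -> Prop) :
  (forall f, P f <-> Q f) -> stack_of P -> stack_of Q.
Proof. by move=> PQ [S stS SP]; exists S => // f; rewrite SP PQ. Qed.

Lemma stack_of1 a b c (d : int) : uniq [:: a; b; c; d] -> stack_of (eq [fset a; b; c; d]).
Proof.
move=> u; exists [fset [fset a; b; c; d]]; first by apply: stacked1; exact: card_quad.
by move=> f; rewrite inE; split=> [/eqP->|->].
Qed.

Lemma stack_of_add (P : {fset int} -> Prop) a b c (d : int) f : stack_of P ->
  P f -> [&& b \in f, c \in f & d \in f] -> uniq [:: b; c; d] ->
  (forall g, P g -> a \notin g) -> stack_of (fun g => P g \/ g = [fset a; b; c; d]).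
Proof.
move=> [S stS SP] Pf bcd ubcd aP; exists ([fset a; b; c; d] |` S).
  rewrite quad_rotate; apply: (stackedU (f := f)) => //; last by move=> g /SP/aP.
  - exact/SP.
  - by rewrite sub_triple.
  - exact: card_triple.
move=> g; rewrite inE in_fset1; split=> [/orP[/eqP->|/SP]|[/SP->|->]].
- by right.
- by left.
- by rewrite orbT.
- by rewrite eqxx.
Qed.

(** In each added simplex [a i] is the new vertex, and the face opposite to it may lie in a facet
    added at an earlier step. *)
Lemma stack_of_iter (P : {fset int} -> Prop) (a b c d : nat -> int) (k : nat) :
  stack_of P ->
  (forall i, (i < k)%N ->
    let Q g := P g \/ exists2 j, (j < i)%N & g = [fset a j; b j; c j; d j] in
    [/\ exists2 f, Q f & [&& b i \in f, c i \in f & d i \in f],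
        uniq [:: b i; c i; d i] & forall g, Q g -> a i \notin g]) ->
  stack_of (fun g => P g \/ exists2 j, (j < k)%N & g = [fset a j; b j; c j; d j]).
Proof.
move=> stP; elim: k => [_|k IH att].
  by apply: stack_of_ext stP => f; split=> [|[//|[]//]]; left.
have {}IH := IH (fun i ik => att i (ltnW ik)).
have [[f Qf bcd] ubcd aQ] := att k (ltnSn k).
apply: stack_of_ext (stack_of_add IH Qf bcd ubcd aQ) => g; split.
  move=> [[Pg|[j jk ->]]|->]; [by left|right..]; last by exists k.
  by exists j => //; exact: ltnW.
move=> [Pg|[j]]; first by left; left.
rewrite ltnS leq_eqVlt => /orP[/eqP->|jk] ->; first by right.
by left; right; exists j.
Qed.

(* Facets of B^{3,1}_n; for negative [j], the pair [j, j + 1] is an edge of the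
   negative half of the path (-1, ..., -(n-2), 1, ..., n-2). *)
Definition B31_facet (n : nat) f : Prop :=
  let N := n%:Z in
  [\/ exists2 j : int, (1 <= j <= N - 3) || (2 - N <= j <= -2) & f = [fset j; j + 1; N - 1; N],
      f = [fset 1; 2 - N; N - 1; N], f = [fset 1; 2 - N; 1 - N; N]
    | f = [fset 1; 2 - N; 1 - N; - N]].

(** The common starting block of the stackings of $B^{3,1}_n$ and $B(I)$. *)
Definition core_facet (n : nat) f : Prop :=
  let N := n%:Z in
  [\/ f = [fset 1; 2; N - 1; N], f = [fset 1; 2 - N; N - 1; N], f = [fset 1; 2 - N; 1 - N; N]
    | f = [fset 1; 2 - N; 1 - N; - N]].

Lemma core_stack n : (4 <= n)%N -> stack_of (core_facet n).
Proof.
move=> n4; set N := n%:Z.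
(* After this simplex the new vertices are [2 - N], [1 - N] and [- N], in this order. *)
have s1 : stack_of (eq [fset 1; 2; N - 1; N]) by apply: stack_of1; rewrite /= !inE /N; lia.
have s2 : stack_of (fun g => [fset 1; 2; N - 1; N] = g \/ g = [fset 2 - N; 1; N - 1; N]).
  apply: (stack_of_add s1 erefl); rewrite /= ?in_quad ?inE ?eqxx ?orbT //.
    by rewrite /N; lia.
  by move=> g <-; rewrite in_quad /N; lia.
have s3 : stack_of (fun g => ([fset 1; 2; N - 1; N] = g \/ g = [fset 2 - N; 1; N - 1; N])
    \/ g = [fset 1 - N; 1; 2 - N; N]).
  apply: (stack_of_add s2 (or_intror erefl)); rewrite /= ?in_quad ?inE ?eqxx ?orbT //.
    by rewrite /N; lia.
  by move=> g [<-|->]; rewrite in_quad /N; lia.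
have s4 : stack_of (fun g => (([fset 1; 2; N - 1; N] = g \/ g = [fset 2 - N; 1; N - 1; N])
    \/ g = [fset 1 - N; 1; 2 - N; N]) \/ g = [fset - N; 1; 2 - N; 1 - N]).
  apply: (stack_of_add s3 (or_intror erefl)); rewrite /= ?in_quad ?inE ?eqxx ?orbT //.
    by rewrite /N; lia.
  by move=> g [[<-|->]|->]; rewrite in_quad /N; lia.
apply: stack_of_ext s4 => f; split.
  move=> [[[<-|->]|->]|->]; [by constructor 1|constructor 2|constructor 3|constructor 4];
  by apply/fsetP => x; rewrite !in_quad; lia.
move=> [] ->; [by do 3 left|left; left; right|left; right|right];
  by apply/fsetP => x; rewrite !in_quad; lia.
Qed.

Lemma B31_stack n : (4 <= n)%N -> stack_of (B31_facet n).
Proof.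
move=> n4; set N := n%:Z.
(* All path facets share the edge [{N - 1, N}]. The positive half of the path grows from 2 up to
   [N - 2], the negative half from [2 - N] up to -1. *)
have up := @stack_of_iter _ (fun i => i%:Z + 3) (fun i => i%:Z + 2) (fun=> N - 1) (fun=> N)
  (n - 4) (core_stack n4).
have down := @stack_of_iter _ (fun i => - (N - 3 - i%:Z)) (fun i => - (N - 2 - i%:Z))
  (fun=> N - 1) (fun=> N) (n - 3) (up _).
apply: stack_of_ext (down _ _) => [f|i il|i il].
- split.
  + move=> [[[->|->|->|->]|[j jn ->]]|[j jn ->]].
    * constructor 1; exists 1; first by rewrite /N; lia.
      by apply/fsetP => x; rewrite !in_quad; lia.
    * by constructor 2.
    * by constructor 3.
    * by constructor 4.
    * constructor 1; exists (j%:Z + 2); first by rewrite /N; lia.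
      by apply/fsetP => x; rewrite !in_quad; lia.
    * constructor 1; exists (- (N - 2 - j%:Z)); first by rewrite /N; lia.
      by apply/fsetP => x; rewrite !in_quad; lia.
  + move=> [[j jN ->]|->|->|->].
    * case/orP: jN => jN; last first.
        right; exists `|(j - (2 - N))%R|%N; first by rewrite /N; lia.
        by apply/fsetP => x; rewrite !in_quad /N; lia.
      left; have [->|j1] := eqVneq j 1.
        by left; constructor 1; apply/fsetP => x; rewrite !in_quad; lia.
      right; exists `|(j - 2)%R|%N; first by rewrite /N; lia.
      by apply/fsetP => x; rewrite !in_quad /N; lia.
    * by do 2 left; constructor 2.
    * by do 2 left; constructor 3.
    * by do 2 left; constructor 4.
- split; last 1 first.
  + move=> g [[->|->|->|->]|[j jn ->]]; rewrite in_quad /N; lia.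
  + case: i il => [|i] il.
      by eexists; [left; constructor 1; reflexivity|rewrite !in_quad; lia].
    by eexists; [right; exists i; [exact: ltnSn|reflexivity]|rewrite !in_quad; lia].
  + by rewrite /= !inE /N; lia.
- split; last 1 first.
  + move=> g [[[->|->|->|->]|[j jn ->]]|[j jn ->]]; rewrite in_quad /N; lia.
  + case: i il => [|i] il.
      by eexists; [do 2 left; constructor 2; reflexivity|rewrite !in_quad /N; lia].
    by eexists; [right; exists i; [exact: ltnSn|reflexivity]|rewrite !in_quad; lia].
  + by rewrite /= !inE /N; lia.
Qed.

Lemma quad_eq a b c (d : int) g :
  [fset a; b; c; d] = g -> [&& a \in g, b \in g, c \in g & d \in g].
Proof. by move=> <-; rewrite -sub_quad. Qed.

(** The path $(-1,\dots,-p,1,\dots,p)$, that is, the cycle [Delta1 p] without its edge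
    $\{-1,p\}$. *)
Definition path_edge (p : nat) e : Prop :=
  (exists2 j : int, (1 <= j <= p%:Z - 1) || (- p%:Z <= j <= -2) & e = [fset j; j + 1])
  \/ e = [fset 1; - p%:Z].

Lemma Delta1_edges p : (2 <= p)%N -> exists2 E : {fset {fset int}}, Delta1 p = generated E &
  forall e, e \in E <-> path_edge p e \/ e = [fset -1; p%:Z].
Proof.
move=> p2; rewrite /Delta1 /cycle_complex; eexists; first by [].
set c := _ ++ _ => e.
have sc : size c = (p + p)%N by rewrite size_cat !size_map size_iota.
have nc i : (i < p + p)%N -> nth 0 c i = if (i < p)%N then i.+1%:Z else - (i - p).+1%:Z.
  move=> ip; rewrite nth_cat size_map size_iota; case: ifP => ilt.
    by rewrite (nth_map 0%N) ?size_iota // nth_iota.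
  by rewrite (nth_map 0%N) ?size_iota ?nth_iota //; lia.
have nr i : (i < p + p)%N -> nth 0 (rot 1 c) i = nth 0 c (if (i.+1 == p + p)%N then 0%N else i.+1).
  move=> ip; rewrite /rot nth_cat size_drop sc nth_drop add1n; case: ifP => ilt.
    by rewrite ifN //; lia.
  rewrite nth_take ?ifT; try lia.
  by congr (nth 0 c _); lia.
have sz : size (zip c (rot 1 c)) = (p + p)%N by rewrite size_zip size_rot minnn.
have edge i : (i < p + p)%N -> [fset (nth (0, 0) (zip c (rot 1 c)) i).1;
    (nth (0, 0) (zip c (rot 1 c)) i).2] \in [fset [fset q.1; q.2] | q in zip c (rot 1 c)].
  move=> ip; apply/imfsetP; exists (nth (0, 0) (zip c (rot 1 c)) i) => //=.
  by apply: mem_nth; rewrite sz.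
split.
  case/imfsetP => q /= /(nthP (0, 0))[i]; rewrite sz => ip <- ->.
  rewrite nth_zip ?size_rot //= nr // !nc //; last by case: eqP; lia.
  have [iE|iE] := eqVneq i.+1 (p + p)%N.
    rewrite ifN; last by lia.
    left; right; rewrite fsetUC; congr [fset _; _]; first by rewrite ifT //; lia.
    by lia.
  have [ilt|ige] := ltnP i p; have [ilt'|ige'] := ltnP i.+1 p; try lia.
  - left; left; exists i.+1%:Z; first by lia.
    by congr [fset _; _]; lia.
  - right; rewrite fsetUC; congr [fset _; _]; lia.
  - left; left; exists (- (i.+1 - p).+1%:Z); first by lia.
    by rewrite fsetUC; congr [fset _; _]; lia.
have edgeE i x y : (i < p + p)%N -> nth 0 c i = x ->
    nth 0 c (if (i.+1 == p + p)%N then 0%N else i.+1) = y ->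
    [fset x; y] \in [fset [fset q.1; q.2] | q in zip c (rot 1 c)].
  by move=> ip <- <-; rewrite -nr //; have := edge i ip; rewrite nth_zip ?size_rot.
clearbody c; clear nr edge; move=> [[[j /orP[] jp ->]|->]|->].
- apply: (edgeE `|(j - 1)%R|%N); first lia.
    by rewrite nc; [rewrite ifT|]; lia.
  by rewrite ifN ?nc; [rewrite ifT|..]; lia.
(* The cycle runs through the negative vertices away from zero, so it meets [j + 1] before [j]; the
   index is the position of [j + 1]. *)
- rewrite fsetUC; apply: (edgeE (p + `|(j + 2)%R|)%N); first lia.
    by rewrite nc; [rewrite ifN|]; lia.
  by rewrite ifN ?nc; [rewrite ifN|..]; lia.
- rewrite fsetUC; apply: (edgeE (p + p).-1%N); first lia.
    by rewrite nc; [rewrite ifN|]; lia.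
  by rewrite ifT ?nc; [rewrite ifT|..]; lia.
- rewrite fsetUC; apply: (edgeE p.-1%N); first lia.
    by rewrite nc; [rewrite ifT|]; lia.
  by rewrite ifN ?nc; [rewrite ifN|..]; lia.
Qed.

Lemma B1_path p : (2 <= p)%N -> exists2 E : {fset {fset int}}, B1 1 p = generated E &
  forall e, e \in E <-> path_edge p e.
Proof.
move=> p2; have [E DE EP] := Delta1_edges p2.
have szE : {in E, forall e, #|` e| = 2}.
  move=> e /EP[[[j jp ->]|->]|->]; rewrite cardfs2; lia.
have neq e : path_edge p e -> e <> [fset -1; p%:Z].
  move=> Pe eE; have e1 : -1 \in e by rewrite eE !inE.
  have ep : p%:Z \in e by rewrite eE !inE eqxx orbT.
  by case: Pe e1 ep => [[j jp ->]|->]; rewrite !inE; lia.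
exists [fset s in E | s \notin simplex [fset -1; p%:Z]].
  by rewrite /B1 /complex_diff DE (facets_generated szE).
move=> e; rewrite !inE /= fpowersetE; split.
  by case/andP => /EP[//|->]; rewrite fsubset_refl.
move=> Pe; have eE : e \in E by apply/EP; left.
rewrite eE /=; apply/negP => /card_subset_eq E2; apply: (neq e Pe); apply: E2.
by rewrite (szE _ eE) cardfs2; case: eqP.
Qed.

(** Two levels of the recursion are unfolded. The path edges of $B^{1,1}_{n-2}$ joined with $n-1$
    and $n$ give the first two kinds of facets; $-B^{1,0}_{n-2}$ joined with $1-n$ and $n$ gives the
    third, and $-B^{2,0}_{n-1}$ joined with $-n$ the last. *)
Lemma B31_generated n S : (4 <= n)%N -> (forall f, f \in S <-> B31_facet n f) ->
  Bjoin (B_step 2 B1) 1 n = generated S.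
Proof.
move=> n4 SP; rewrite /Bjoin /B_step /= /Bjoin fsetU0.
have [|E -> EP] := @B1_path n.-1.-1; first by lia.
rewrite /B1 simplexE !(cone_generated, neg_generated, generatedU).
congr generated; apply/fsetP => f; apply/idP/idP.
  rewrite in_fsetU => fE; apply/SP; move: fE.
  case/orP => /imfsetP[g /=].
    rewrite in_fsetU => /orP[] /imfsetP[e /=].
      move=> /EP[[j jp ->]|->] -> ->; [constructor 1; exists j|constructor 2];
        try lia; by apply/fsetP => x; rewrite !inE; lia.
    rewrite in_neg inE => /eqP/(congr1 neg_face); rewrite neg_faceK => -> -> ->.
    constructor 3; apply/fsetP => x; rewrite !inE in_neg_face !inE; lia.
  rewrite in_neg => /imfsetP[e /=]; rewrite inE => /eqP -> /(congr1 neg_face).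
  rewrite neg_faceK => -> ->.
  constructor 4; apply/fsetP => x; rewrite !inE in_neg_face !inE; lia.
move=> /SP[[j jn ->]|->|->|->]; rewrite in_fsetU; apply/orP.
- left; apply/imfsetP; exists (n.-1%:Z |` [fset j; j + 1]) => /=; last first.
    by apply/fsetP => x; rewrite !inE; lia.
  rewrite in_fsetU; apply/orP; left; apply/imfsetP; exists [fset j; j + 1] => //=.
  by apply/EP; left; exists j => //; lia.
- left; apply/imfsetP; exists (n.-1%:Z |` [fset 1; - n.-1.-1%:Z]) => /=; last first.
    by apply/fsetP => x; rewrite !inE; lia.
  rewrite in_fsetU; apply/orP; left; apply/imfsetP; exists [fset 1; - n.-1.-1%:Z] => //=.
  by apply/EP; right.
- left; apply/imfsetP; exists (- n.-1%:Z |` neg_face [fset -1; n.-1.-1%:Z]) => /=; last first.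
    by apply/fsetP => x; rewrite !inE in_neg_face !inE; lia.
  rewrite in_fsetU; apply/orP; right; apply/imfsetP; eexists; last by reflexivity.
  by rewrite /= in_neg neg_faceK inE.
- right; apply/imfsetP; exists (neg_face (n.-1%:Z |` [fset -1; n.-1.-1%:Z])) => /=; last first.
    by apply/fsetP => x; rewrite !inE in_neg_face !inE; lia.
  rewrite in_neg neg_faceK; apply/imfsetP; eexists; last by reflexivity.
  by rewrite /= inE.
Qed.

Lemma B31_antipodal n f : (4 <= n)%N -> B31_facet n f -> B31_facet n (neg_face f) -> False.
Proof.
move=> n4 [[j jn ->]|->|->|->]; rewrite neg_quad;
by case=> [[k kn]|||] /quad_eq; rewrite !in_quad; lia.
Qed.

Lemma B31_cover n v : (4 <= n)%N -> v \in Vset n -> exists2 f, B31_facet n f & v \in f.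
Proof.
move=> n4; rewrite in_Vset => vn.
have path j : (1 <= j <= n%:Z - 3) || (2 - n%:Z <= j <= -2) ->
    B31_facet n [fset j; j + 1; n%:Z - 1; n%:Z] by move=> jn; constructor 1; exists j.
case: (lerP 0 v) => v0.
  case: (lerP v (n%:Z - 3)) => v1.
    by eexists; [apply: (path v); lia|rewrite in_quad eqxx].
  by eexists; [apply: (path (n%:Z - 3)); lia|rewrite in_quad; lia].
case: (lerP v (1 - n%:Z)) => v1.
  by eexists; [constructor 4; reflexivity|rewrite in_quad; lia].
have [->|v2] := eqVneq v (-1).
  by eexists; [apply: (path (-2)); lia|rewrite in_quad; lia].
by eexists; [apply: (path v); lia|rewrite in_quad eqxx].
Qed.

Lemma B31_ridge n S a b c f : (forall f, f \in S <-> B31_facet n f) ->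
  uniq [:: a; b; c] -> B31_facet n f -> [fset a; b; c] `<=` f ->
  (forall g, B31_facet n g -> [fset a; b; c] `<=` g -> g = f) ->
  [fset a; b; c] \in ridges 3 S.
Proof.
move=> SP uabc Bf tf uf; apply/ridgesP; split; first exact: card_triple.
by exists f; split=> //; [apply/SP|move=> g /SP; exact: uf].
Qed.

Lemma B31_ridge_path n S j : (4 <= n)%N -> (forall f, f \in S <-> B31_facet n f) ->
  (1 <= j <= n%:Z - 3) || (2 - n%:Z <= j <= -2) -> [fset j; j + 1; n%:Z - 1] \in ridges 3 S.
Proof.
move=> n4 SP jn; apply: (B31_ridge (f := [fset j; j + 1; n%:Z - 1; n%:Z]) SP).
- by rewrite /= !inE; lia.
- by constructor 1; exists j.
- by rewrite sub_triple !in_quad; lia.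
- move=> g [[k kn]|||] -> /[!sub_triple] /[!in_quad] H; try by exfalso; lia.
  have -> // : k = j by lia.
Qed.

(** The last field makes the next replacement possible and is therefore proved along with the
    sphere. *)
Record Delta3_spec (R : realType) (n : nat) F : Prop := Delta3Spec {
  Delta3_generated : Delta 3 n = generated F;
  Delta3_sphere : cs2_sphere R n F;
  Delta3_B31 : forall f, B31_facet n f -> f \in F }.

(** This places $B^{3,1}_{n+1}$ inside $\Delta^3_{n+1}$: each of its facets is one of those created
    when $\pm B^{3,1}_n$ is replaced by cones. *)
Lemma B31_next n S f : (4 <= n)%N -> (forall f, f \in S <-> B31_facet n f) ->
  B31_facet n.+1 f -> exists2 t, t \in ridges 3 S & f = n.+1%:Z |` t \/ f = neg_face (n.+1%:Z |` t).
Proof.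
move=> n4 SP; set N := n%:Z.
have apex a b c : [fset a; b; c; n.+1%:Z] = n.+1%:Z |` [fset a; b; c].
  by apply/fsetP => x; rewrite !inE orbC.
have N1 : n.+1%:Z - 1 = N by rewrite /N; lia.
have mid g : [fset 1; 1 - N] `<=` g -> B31_facet n g ->
    g = [fset 1; 2 - N; 1 - N; N] \/ g = [fset 1; 2 - N; 1 - N; - N].
  rewrite fsubUset !fsub1set => H [[k kn]|||] E; move: H; rewrite E !in_quad => H; try by exfalso; lia.
    by left.
  by right.
move=> [[j jn ->]|->|->|->].
- exists [fset j; j + 1; N]; last by left; rewrite -apex N1.
  have [jp|jp] := boolP ((1 <= j <= N - 3) || (2 - N <= j <= -2)).
    apply: (B31_ridge (f := [fset j; j + 1; N - 1; N]) SP).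
    + by rewrite /= !inE; lia.
    + by constructor 1; exists j.
    + by rewrite sub_triple !in_quad; lia.
    + move=> g [[k kn]|||] -> /[!sub_triple] /[!in_quad] H; try by exfalso; lia.
      have -> // : k = j by lia.
  (* The path gains one edge at the end of each half; those two triangles lie in other facets of
     $B^{3,1}_n$. *)
  have [jE|jE] : j = N - 2 \/ j = 1 - N by lia.
    apply: (B31_ridge (f := [fset N - 3; N - 3 + 1; N - 1; N]) SP).
    + by rewrite /= !inE; lia.
    + by constructor 1; exists (N - 3) => //; lia.
    + by rewrite sub_triple !in_quad; lia.
    + move=> g [[k kn]|||] -> /[!sub_triple] /[!in_quad] H; try by exfalso; lia.
      have -> // : k = N - 3 by lia.
  apply: (B31_ridge (f := [fset 1; 2 - N; 1 - N; N]) SP).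
  + by rewrite /= !inE; lia.
  + by constructor 3.
  + by rewrite sub_triple !in_quad; lia.
  + move=> g [[k kn]|||] -> /[!sub_triple] /[!in_quad] H; try by exfalso; lia.
    by [].
- exists [fset 1; 1 - N; N]; last first.
    by left; rewrite -apex; apply/fsetP => x; rewrite !in_quad /N; lia.
  apply: (B31_ridge (f := [fset 1; 2 - N; 1 - N; N]) SP).
  + by rewrite /= !inE; lia.
  + by constructor 3.
  + by rewrite sub_triple !in_quad; lia.
  + move=> g [[k kn]|||] -> /[!sub_triple] /[!in_quad] H; try by exfalso; lia.
    by [].
- exists [fset 1; 1 - N; - N]; last first.
    by left; rewrite -apex; apply/fsetP => x; rewrite !in_quad /N; lia.
  apply: (B31_ridge (f := [fset 1; 2 - N; 1 - N; - N]) SP).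
  + by rewrite /= !inE; lia.
  + by constructor 4.
  + by rewrite sub_triple !in_quad; lia.
  + move=> g [[k kn]|||] -> /[!sub_triple] /[!in_quad] H; try by exfalso; lia.
    by [].
(* The facet with vertex $-(n+1)$ arises from the antipodal cone, so its ridge is read off after
   negation. *)
- exists [fset -1; N - 1; N]; last first.
    right; rewrite -apex neg_quad; apply/fsetP => x; rewrite !in_quad /N; lia.
  apply: (B31_ridge (f := [fset -2; -2 + 1; N - 1; N]) SP).
  + by rewrite /= !inE; lia.
  + by constructor 1; exists (-2) => //; lia.
  + by rewrite sub_triple !in_quad; lia.
  + move=> g [[k kn]|||] -> /[!sub_triple] /[!in_quad] H; try by exfalso; lia.
    have -> // : k = -2 by lia.
Qed.

Lemma Delta3_base R : Delta3_spec R 4 (crosspolytope_facets 4).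
Proof.
split; [exact: crosspolytope_generated|exact: crosspolytope_sphere|].
have quad a b c (d : int) : [&& a \in Vset 4, b \in Vset 4, c \in Vset 4 & d \in Vset 4] ->
    uniq [:: `|a|; `|b|; `|c|; `|d|]%N -> [fset a; b; c; d] \in crosspolytope_facets 4.
  move=> V4 u; have u4 := @map_uniq _ _ absz [:: a; b; c; d] u.
  apply/crosspolytope_facetsP; move: u; rewrite /= !inE => u; split.
  - by rewrite sub_quad.
  - move: V4; rewrite !in_Vset => /and4P[/andP[a0 _] /andP[b0 _] /andP[c0 _] /andP[d0 _]].
    move: u; rewrite !negb_or => /andP[/and3P[ab ac ad] /andP[/andP[bc bd] /andP[cd _]]].
    by apply/allP => v; rewrite !in_quad !negb_or => /or4P[] /eqP ->; apply/and4P; split; lia.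
  - exact: card_quad.
by move=> f [[j jn ->]|->|->|->]; apply: quad; rewrite /= ?in_Vset ?inE; lia.
Qed.

(** Quantifying over every [S] with the facets of $B^{3,1}_n$ makes the description of the new
    facets independent of the particular stacking. *)
Lemma Delta3_step R n F : (4 <= n)%N -> Delta3_spec R n F -> exists F',
  Delta3_spec R n.+1 F' /\ (forall f, f \in F' <->
    [\/ [/\ f \in F, ~ B31_facet n f & ~ B31_facet n (neg_face f)]
      | exists2 t, (forall S, (forall f, f \in S <-> B31_facet n f) -> t \in ridges 3 S) &
          f = n.+1%:Z |` t \/ f = neg_face (n.+1%:Z |` t)]).
Proof.
move=> n4 [DF goodF BF]; have [S stS SP] := B31_stack n4.
have SF : S `<=` F by apply/fsubsetP => f /SP/BF.
have SN : {in S, forall s, neg_face s \notin S}.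
  by move=> s /SP sB; apply/negP => /SP; exact: B31_antipodal.
have cov v : v \in Vset n -> exists2 s, s \in S & v \in s.
  by move=> /(B31_cover n4)[s /SP sS vs]; exists s.
have n0 : (0 < n)%N by exact: leq_trans n4.
have SE S' : (forall f, f \in S' <-> B31_facet n f) -> S' = S.
  by move=> SP'; apply/fsetP => f; apply/idP/idP => [/SP'/SP|/SP/SP'].
exists (cs_restack F S n.+1%:Z); split; first split.
- rewrite -(cs_replace_generated n0 goodF stS SF) -DF -(B31_generated n4 SP) /Delta /=.
  by rewrite ifN // -ltnNge.
- exact: cs_restack_sphere.
- move=> f /(B31_next n4 SP)[t tS ft]; apply/(cs_restackP n0 goodF SF).
  by case: ft; [constructor 2|constructor 3]; exists t.
move=> f; split=> [/(cs_restackP n0 goodF SF)|H]; last apply/(cs_restackP n0 goodF SF).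
  case=> [[fF fS fN]|[t tS ->]|[t tS ->]].
  - by constructor 1; split=> // /SP; apply/negP.
  - by constructor 2; exists t; [move=> S' /SE ->|left].
  - by constructor 2; exists t; [move=> S' /SE ->|right].
case: H => [[fF fS fN]|[t tS [->|->]]].
- by constructor 1; split=> //; apply/negP => /SP.
- by constructor 2; exists t => //; exact: tS.
- by constructor 3; exists t => //; exact: tS.
Qed.

(** * The balls B(I) *)

Lemma idx_bounds n I j : index_family n I -> (j < size I)%N -> (3 <= idx n I j <= n - 6)%N.
Proof. by case=> _ /all_nthP H _ /(H (n - 2)%N). Qed.

Lemma idx_last n I : idx n I (size I) = (n - 2)%N.
Proof. by rewrite /idx nth_default. Qed.

Lemma idx_next n I j : (10 <= n)%N -> index_family n I -> (j < size I)%N ->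
  (idx n I j < idx n I j.+1)%N.
Proof.
move=> n10 fI jI; have := idx_bounds fI jI; case: (ltnP j.+1 (size I)) => jI'.
  move=> _; case: fI => sI _ _; apply: (sorted_ltn_nth ltn_trans) => //.
have -> : j.+1 = size I by apply/eqP; rewrite eqn_leq jI jI'.
by rewrite idx_last; lia.
Qed.

Lemma idx_mono n I i j : (10 <= n)%N -> index_family n I -> (i <= j <= size I)%N ->
  (idx n I i <= idx n I j)%N.
Proof.
move=> n10 fI /andP[ij]; elim: j ij => [|j IH]; first by rewrite leqn0 => /eqP ->.
rewrite leq_eqVlt => /orP[/eqP -> //|ij] jI; apply: leq_trans (ltnW (idx_next n10 fI jI)).
by apply: IH; rewrite // ltnW.
Qed.

Lemma idx0_bounds n I : (10 <= n)%N -> index_family n I -> (3 <= idx n I 0 <= n - 2)%N.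
Proof.
move=> n10 fI; case: (posnP (size I)) => [I0|/(idx_bounds fI)]; last lia.
by have := idx_last n I; rewrite I0 => ->; lia.
Qed.

Definition BI_block (n p q : nat) f : Prop :=
  let N := n%:Z in
  f = [fset 1; p%:Z + 2 - N; N - p%:Z - 1; N - p%:Z + 1] \/
  exists2 m : int, p%:Z + 2 <= m <= q%:Z & f = [fset m + 1 - N; m - N; N - p%:Z - 1; N - p%:Z + 1].

(** The portion of $B(I)$ consisting of the part before the blocks and the first [k] blocks; the
    stacking proceeds by induction on [k]. *)
Definition BI_part (n : nat) (I : seq nat) (k : nat) f : Prop :=
  let N := n%:Z in
  ((core_facet n f \/ exists2 i : int, 3 <= i <= N - 2 & f = [fset i; 1; 2; i + 2]) \/
    exists2 m : int, 2 <= m <= (idx n I 0)%:Z & f = [fset m + 1 - N; m - N; N - 1; N]) \/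
  exists2 j, (j < k)%N & BI_block n (idx n I j) (idx n I j.+1) f.

Lemma BI_facetsP n I f : (10 <= n)%N -> index_family n I ->
  (f \in BI_facets n I) <-> BI_part n I (size I) f.
Proof.
move=> n10 fI; rewrite /BI_facets; cbv zeta; rewrite !mem_cat; split.
  case/or4P => [/mapP[i]|||].
  - rewrite mem_index_iota => ilt ->; left; left; right; exists i%:Z; first by lia.
    by apply/fsetP => x; rewrite !in_quad; lia.
  - rewrite !inE => /or4P[] /eqP ->; do 3 left;
    [constructor 1|constructor 2|constructor 3|constructor 4];
    by apply/fsetP => x; rewrite !in_quad; lia.
  - case/mapP => m; rewrite mem_index_iota => mlt ->; left; right; exists m%:Z; first by lia.
    by apply/fsetP => x; rewrite !in_quad; lia.
  - case/flattenP => B /mapP[j]; rewrite mem_iota add0n => jlt ->.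
    rewrite inE => H; right; exists j => //; case/orP: H => [/eqP ->|/mapP[m]].
      by left; apply/fsetP => x; rewrite !in_quad; lia.
    rewrite mem_index_iota => mlt ->; right; exists m%:Z; first by lia.
    by apply/fsetP => x; rewrite !in_quad; lia.
move=> H; apply/or4P; case: H => [[[|[i ilt ->]]|[m mlt ->]]|[j jlt [->|[m mlt ->]]]].
- move=> H; constructor 2; rewrite !inE; apply/or4P.
  by case: H => ->; [constructor 1|constructor 2|constructor 3|constructor 4];
  apply/eqP/fsetP => x; rewrite !in_quad; lia.
- constructor 1; apply/mapP; exists `|i|%N; first by rewrite mem_index_iota; lia.
  by apply/fsetP => x; rewrite !in_quad; lia.
- constructor 3; apply/mapP; exists `|m|%N; first by rewrite mem_index_iota; lia.
  by apply/fsetP => x; rewrite !in_quad; lia.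
- constructor 4; apply/flattenP; eexists.
    by apply/mapP; exists j; [rewrite mem_iota|reflexivity].
  rewrite inE; apply/orP; left; apply/eqP/fsetP => x; rewrite !in_quad; lia.
- constructor 4; apply/flattenP; eexists.
    by apply/mapP; exists j; [rewrite mem_iota|reflexivity].
  rewrite inE; apply/orP; right; apply/mapP; exists `|m|%N; first by rewrite mem_index_iota; lia.
  by apply/fsetP => x; rewrite !in_quad; lia.
Qed.

Lemma BI_part_vertex n I k f x : (10 <= n)%N -> index_family n I -> (k <= size I)%N ->
  BI_part n I k f -> x \in f -> (0 < x) || (x <= (idx n I k)%:Z + 1 - n%:Z).
Proof.
move=> n10 fI kI; have i0 := idx0_bounds n10 fI.
have ik : (idx n I 0 <= idx n I k)%N by apply: idx_mono; rewrite ?kI.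
case=> [[[[]|[i ilt]]|[m mlt]]|[j jk H]]; try by move=> ->; rewrite in_quad; lia.
have jI := leq_trans jk kI; have ib := idx_bounds fI jI.
have in_ := idx_next n10 fI jI; have im : (idx n I j.+1 <= idx n I k)%N by apply: idx_mono; rewrite ?jk.
by case: H => [|[m mlt]] ->; rewrite in_quad; lia.
Qed.

Lemma BI_stack n I : (10 <= n)%N -> index_family n I -> stack_of (BI_part n I (size I)).
Proof.
move=> n10 fI; have i0 := idx0_bounds n10 fI; set N := n%:Z.
have n4 : (4 <= n)%N by lia.
(* The vertices [N - 2] down to 3 are added in turn. Each simplex is glued to the one two steps
   earlier, the first two to [{1, 2, N - 1, N}], so the two parities form interleaved chains. *)
have chain := @stack_of_iter _ (fun i => N - 2 - i%:Z) (fun=> 1) (fun=> 2) (fun i => N - i%:Z)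
  (n - 4) (core_stack n4).
have {}chain : stack_of (fun f => core_facet n f \/
    exists2 i : int, 3 <= i <= N - 2 & f = [fset i; 1; 2; i + 2]).
  apply: stack_of_ext (chain _) => [f|i il].
    split=> [[H|[i il ->]]|[H|[i il ->]]]; [by left| |by left|]; right.
      exists (N - 2 - i%:Z); first by rewrite /N; lia.
      by apply/fsetP => x; rewrite !in_quad; lia.
    exists `|(N - 2 - i)%R|%N; first by rewrite /N; lia.
    by apply/fsetP => x; rewrite !in_quad /N; lia.
  split; last by move=> g [[]|[j jn]] ->; rewrite in_quad /N; lia.
    case: i il => [|[|i]] il.
    - by eexists; [left; constructor 1; reflexivity|rewrite !in_quad /N; lia].
    - by eexists; [left; constructor 1; reflexivity|rewrite !in_quad /N; lia].
    - by eexists; [right; exists i; [|reflexivity]|rewrite !in_quad]; lia.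
  by rewrite /= !inE /N; lia.
(* These simplices all contain [{N - 1, N}] and continue from [{1, 2 - N, N - 1, N}] of the core. *)
have first := @stack_of_iter _ (fun i => i%:Z + 3 - N) (fun i => i%:Z + 2 - N) (fun=> N - 1) (fun=> N)
  (idx n I 0).-1 chain.
have {chain}first : stack_of (BI_part n I 0).
  apply: stack_of_ext (first _) => [f|i il].
    split=> [[H|[i il ->]]|[[H|[i il ->]]|[j]//]]; [by left; left| |by left|].
      left; right; exists (i%:Z + 2); first by lia.
      by apply/fsetP => x; rewrite !in_quad /N; lia.
    right; exists `|(i - 2)%R|%N; first by lia.
    by apply/fsetP => x; rewrite !in_quad /N; lia.
  split; last by move=> g [[[]|[k kn]]|[j jn]] ->; rewrite in_quad /N; lia.
    case: i il => [|i] il.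
      by eexists; [left; left; constructor 2; reflexivity|rewrite !in_quad /N; lia].
    by eexists; [right; exists i; [exact: ltnSn|reflexivity]|rewrite !in_quad; lia].
  by rewrite /= !inE /N; lia.
have part k : (k <= size I)%N -> stack_of (BI_part n I k); last exact: part.
elim: k => [//|k IH kI]; have {}IH := IH (ltnW kI).
have pb := idx_bounds fI kI; have pq := idx_next n10 fI kI.
have qn : (idx n I k.+1 <= n - 2)%N.
  by rewrite -(idx_last n I); apply: idx_mono; rewrite // kI leqnn.
have bound g x := @BI_part_vertex n I k g x n10 fI (ltnW kI).
set p := idx n I k in pb pq bound; set q := idx n I k.+1 in pq qn.
(* A block branches off the chain simplex [{1, 2, i, i + 2}] with [i = N - p - 1], glued along the
   face opposite to 2. *)
have head : stack_of (fun g => BI_part n I k g \/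
    g = [fset p%:Z + 2 - N; 1; N - p%:Z - 1; N - p%:Z + 1]).
  apply: (stack_of_add (f := [fset N - p%:Z - 1; 1; 2; N - p%:Z - 1 + 2]) IH).
  - by do 2 left; right; exists (N - p%:Z - 1) => //; rewrite /N; lia.
  - by rewrite !in_quad; lia.
  - by rewrite /= !inE /N; lia.
  - by move=> g Pg; apply/negP => /(bound _ _ Pg); rewrite /N; lia.
(* The rest of the block keeps the edge [{N - p - 1, N - p + 1}] and walks along the negative
   vertices; [m] runs from [p + 2] to [q], which makes [q - p.+1] simplices. *)
have := @stack_of_iter _ (fun i => p%:Z + 3 + i%:Z - N) (fun i => p%:Z + 2 + i%:Z - N)
  (fun=> N - p%:Z - 1) (fun=> N - p%:Z + 1) (q - p.+1) head.
move=> tail; apply: stack_of_ext (tail _) => [f|i il].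
  split=> [[[[H|[j jk H]]|->]|[i il ->]]|[H|[j]]].
  - by left.
  - by right; exists j => //; exact: ltnW.
  - by right; exists k => //; left; apply/fsetP => x; rewrite !in_quad; lia.
  - right; exists k => //; right; exists (p%:Z + 2 + i%:Z); first by rewrite -/q; lia.
    by apply/fsetP => x; rewrite !in_quad; lia.
  - by do 3 left.
  - rewrite ltnS leq_eqVlt => /orP[/eqP ->|jk H]; last by do 2 left; right; exists j.
    rewrite -/p -/q => -[->|[m mq ->]].
      by left; right; apply/fsetP => x; rewrite !in_quad; lia.
    right; exists `|(m - p%:Z - 2)%R|%N; first by lia.
    by apply/fsetP => x; rewrite !in_quad /N; lia.
split; last 1 first.
- move=> g [[Pg|->]|[j jn ->]]; last by rewrite in_quad /N; lia.
    by apply/negP => /(bound _ _ Pg); rewrite /N; lia.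
  by rewrite in_quad /N; lia.
- case: i il => [|i] il.
    by eexists; [left; right; reflexivity|rewrite !in_quad; lia].
  by eexists; [right; exists i; [exact: ltnSn|reflexivity]|rewrite !in_quad; lia].
- by rewrite /= !inE /N; lia.
Qed.

(** * Facets of the spheres that survive from earlier stages, and the position of B(I) *)

Lemma Delta3_facets R n F : Delta3_spec R n F -> F = facets (Delta 3 n).
Proof. by case=> -> goodF _; rewrite (facets_generated (sphere_size goodF)). Qed.

Lemma Delta3_all R n : (4 <= n)%N -> Delta3_spec R n (facets (Delta 3 n)).
Proof.
elim: n => [//|n IH]; rewrite leq_eqVlt => /orP[/eqP <-|n4].
  by have H := Delta3_base R; rewrite -(Delta3_facets H).
have [F [H _]] := Delta3_step n4 (IH n4); by rewrite -(Delta3_facets H).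
Qed.

Lemma Delta3_facetsP (R : realType) n f : (4 <= n)%N -> (f \in facets (Delta 3 n.+1)) <->
    [\/ [/\ f \in facets (Delta 3 n), ~ B31_facet n f & ~ B31_facet n (neg_face f)]
      | exists2 t, (forall S, (forall f, f \in S <-> B31_facet n f) -> t \in ridges 3 S) &
          f = n.+1%:Z |` t \/ f = neg_face (n.+1%:Z |` t)].
Proof.
move=> n4; have [F [H HF]] := Delta3_step n4 (Delta3_all R n4).
by rewrite -(Delta3_facets H) HF.
Qed.

Lemma B31_top n f : B31_facet n f -> (n%:Z \in f) || (- n%:Z \in f).
Proof. by case=> [[j jn]|||] ->; rewrite !in_quad; lia. Qed.

(** Every facet of $B^{3,1}_k$ contains $k$ or $-k$, so a facet on $V_m$ can be removed only at
    stage $m$ itself. *)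
Lemma Delta3_persist (R : realType) m n f : (4 <= m <= n)%N -> f \in facets (Delta 3 m) ->
  ~ B31_facet m f -> ~ B31_facet m (neg_face f) -> f \in facets (Delta 3 n).
Proof.
move=> /andP[m4 mn] fm fB fN; rewrite -(subnKC mn); elim: (n - m)%N => [|k IH].
  by rewrite addn0.
have fV := sphere_sub (Delta3_sphere (Delta3_all R m4)) fm.
have top g : g `<=` Vset m -> (0 < k)%N -> ~ B31_facet (m + k)%N g.
  by move=> gV k0 /B31_top /orP[] /(fsubsetP gV); rewrite in_Vset; lia.
rewrite addnS; apply/(Delta3_facetsP R); first by lia.
constructor 1; split=> //; have [->|k0] := posnP k; rewrite ?addn0 //; apply: top => //.
by apply/fsubsetP => v; rewrite in_neg_face => /(fsubsetP fV); rewrite in_VsetN.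
Qed.

Lemma Delta3_cone (R : realType) k n a b c : (4 <= k < n)%N ->
  (forall S, (forall f, f \in S <-> B31_facet k f) -> [fset a; b; c] \in ridges 3 S) ->
  ~ B31_facet k.+1 [fset a; b; c; k.+1%:Z] ->
  ~ B31_facet k.+1 (neg_face [fset a; b; c; k.+1%:Z]) ->
  [fset a; b; c; k.+1%:Z] \in facets (Delta 3 n).
Proof.
move=> /andP[k4 kn] ridge nB nN; apply: (Delta3_persist R (m := k.+1)) => //.
  by rewrite kn ltnW // ltnS.
apply/(Delta3_facetsP R) => //; constructor 2; exists [fset a; b; c]; first exact: ridge.
by left; apply/fsetP => x; rewrite in_quad !inE; lia.
Qed.

(** Such a facet appears together with the vertex $k+1$ and contains neither $k$ nor $-k$, whereas
    every facet of $\pm B^{3,1}_{k+1}$ contains one of them. *)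
Lemma Delta3_path (R : realType) k n (j : int) : (4 <= k < n)%N ->
  (1 <= j <= k%:Z - 3) || (2 - k%:Z <= j <= -2) ->
  [fset j; j + 1; k%:Z - 1; k.+1%:Z] \in facets (Delta 3 n).
Proof.
move=> kn jk; apply: (Delta3_cone R kn).
- by move=> S SP; apply: B31_ridge_path => //; case/andP: kn.
- by case=> [[i ik]|||] /quad_eq; rewrite !in_quad; lia.
- by rewrite neg_quad; case=> [[i ik]|||] /quad_eq; rewrite !in_quad; lia.
Qed.

Lemma Delta3_turn (R : realType) k n : (4 <= k < n)%N ->
  [fset 1; 2 - k%:Z; k%:Z - 1; k.+1%:Z] \in facets (Delta 3 n).
Proof.
move=> kn; apply: (Delta3_cone R kn).
- move=> S SP; apply: (B31_ridge (f := [fset 1; 2 - k%:Z; k%:Z - 1; k%:Z]) SP).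
  + by rewrite /= !inE; lia.
  + by constructor 2.
  + by rewrite sub_triple !in_quad; lia.
  + move=> g [[i ik]|||] -> /[!sub_triple] /[!in_quad] H; try by exfalso; lia.
    by [].
- by case=> [[i ik]|||] /quad_eq; rewrite !in_quad; lia.
- by rewrite neg_quad; case=> [[i ik]|||] /quad_eq; rewrite !in_quad; lia.
Qed.

(** An envelope of all the balls $B(I)$ that forgets [I]: containment in $\Delta^3_n$ and
    disjointness from the antipode can be checked on it once for all index sets. *)
Definition BI_shape (n : nat) f : Prop :=
  let N := n%:Z in
  [\/ core_facet n f,
      exists2 i : int, 3 <= i <= N - 2 & f = [fset i; 1; 2; i + 2],
      exists2 m : int, 2 <= m <= N - 2 & f = [fset m + 1 - N; m - N; N - 1; N]
    | exists2 p : int, 3 <= p <= N - 6 & f = [fset 1; p + 2 - N; N - p - 1; N - p + 1] \/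
        exists2 m : int, p + 2 <= m <= N - 2 & f = [fset m + 1 - N; m - N; N - p - 1; N - p + 1]].

Lemma BI_part_shape n I f : (10 <= n)%N -> index_family n I -> BI_part n I (size I) f ->
  BI_shape n f.
Proof.
move=> n10 fI; have i0 := idx0_bounds n10 fI.
case=> [[[H|H]|[m mlt ->]]|[j jI H]]; [by constructor 1|by constructor 2| |].
  by constructor 3; exists m => //; lia.
have jb := idx_bounds fI jI; have jn : (idx n I j.+1 <= n - 2)%N.
  by rewrite -(idx_last n I); apply: idx_mono; rewrite // jI leqnn.
constructor 4; exists (idx n I j)%:Z; first by lia.
by case: H => [->|[m mlt ->]]; [left|right; exists m => //; lia].
Qed.

Lemma BI_shape_antipodal n f : (10 <= n)%N -> BI_shape n f -> BI_shape n (neg_face f) -> False.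
Proof.
move=> n10 [[]|[i il]|[m ml]|[p pl [|[m ml]]]] ->; rewrite neg_quad;
by case=> [[]|[i' il']|[m' ml']|[p' pl' [|[m' ml']]]] /quad_eq; rewrite !in_quad; lia.
Qed.

Lemma BI_shape_facet (R : realType) n f : (10 <= n)%N -> BI_shape n f ->
  f \in facets (Delta 3 n).
Proof.
move=> n10; have n4 : (4 <= n)%N by lia.
have BF := Delta3_B31 (Delta3_all R n4).
case=> [core|[i il ->]|[m ml ->]|[p pl]].
- apply: BF; case: core => ->; [|by constructor 2|by constructor 3|by constructor 4].
  constructor 1; exists 1; first by lia.
  by apply/fsetP => x; rewrite !in_quad; lia.
(* The gap pair is [i], [i + 2], so the facet was created right after stage [i + 1], over the path
   edge [{1, 2}]. *)
- have := @Delta3_path R (`|i|.+1)%N n 1; rewrite (_ : [fset _; _; _; _] = [fset i; 1; 2; i + 2]).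
    by apply; lia.
  by apply/fsetP => x; rewrite !in_quad; lia.
- apply: BF; constructor 1; exists (m - n%:Z); first by lia.
  by apply/fsetP => x; rewrite !in_quad; lia.
(* The gap pair $n-p-1,\ n-p+1$ is centred at $k=n-p$; the condition $m\ge p+2$ is what puts $m-n$
   in the range of path edges at stage $k$. *)
pose k := `|(n%:Z - p)%R|%N; have kE : k%:Z = n%:Z - p by rewrite /k; lia.
case=> [->|[m ml ->]].
  have := @Delta3_turn R k n; rewrite (_ : [fset _; _; _; _] = [fset 1; p + 2 - n%:Z; n%:Z - p - 1; n%:Z - p + 1]).
    by apply; lia.
  by apply/fsetP => x; rewrite !in_quad; lia.
have := @Delta3_path R k n (m - n%:Z).
rewrite (_ : [fset _; _; _; _] = [fset m + 1 - n%:Z; m - n%:Z; n%:Z - p - 1; n%:Z - p + 1]).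
  by apply; lia.
by apply/fsetP => x; rewrite !in_quad; lia.
Qed.

Lemma idx_locate n I k (m : nat) : (k <= size I)%N -> (m <= idx n I k)%N ->
  (m <= idx n I 0)%N \/ exists2 j, (j < k)%N & (idx n I j < m <= idx n I j.+1)%N.
Proof.
elim: k => [|k IH] kI mk; first by left.
have [mk'|mk'] := leqP m (idx n I k); last by right; exists k; rewrite // mk' mk.
by case: (IH (ltnW kI) mk') => [|[j jk H]]; [left|right; exists j => //; exact: ltnW].
Qed.

Lemma BI_cover n I v : (10 <= n)%N -> index_family n I -> v \in Vset n ->
  exists2 f, BI_part n I (size I) f & v \in f.
Proof.
move=> n10 fI; rewrite in_Vset => vn; set N := n%:Z.
have [core|ncore] := boolP [|| v == 1, v == 2, v == N - 1 | v == N].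
  by exists [fset 1; 2; N - 1; N]; [do 3 left; constructor 1|rewrite in_quad].
have [core'|ncore'] := boolP [|| v == 1, v == 2 - N, v == 1 - N | v == - N].
  by exists [fset 1; 2 - N; 1 - N; - N]; [do 3 left; constructor 4|rewrite in_quad].
case: (lerP 0 v) => v0.
  exists [fset v; 1; 2; v + 2]; last by rewrite in_quad eqxx.
  by do 2 left; right; exists v => //; rewrite /N; lia.
pose m := `|(v + N - 1)%R|%N; have mE : m%:Z = v + N - 1 by rewrite /m /N; lia.
have mlast : (m <= idx n I (size I))%N by rewrite idx_last /N in mE *; lia.
case: (idx_locate (leqnn _) mlast) => [m0|[j jI /andP[jm mj]]].
  exists [fset m%:Z + 1 - N; m%:Z - N; N - 1; N]; last by rewrite in_quad mE; lia.
  by left; right; exists m%:Z => //; rewrite /N in mE *; lia.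
(* The vertex $i_j+2-n$ occurs as the new vertex of the first simplex of its block; later vertices
   of the block are of the form $m+1-n$ with $m\ge i_j+2$. *)
have [mj1|mj1] := eqVneq m (idx n I j).+1.
  eexists; first by right; exists j => //; left; reflexivity.
  by rewrite in_quad /N in mE *; lia.
exists [fset m%:Z + 1 - N; m%:Z - N; N - (idx n I j)%:Z - 1; N - (idx n I j)%:Z + 1].
  by right; exists j => //; right; exists m%:Z => //; lia.
by rewrite in_quad mE; lia.
Qed.


End SignedSpheres.

Theorem theorem7p6 (R : realType) (n : nat) (I : seq nat) :
  (10 <= n)%N -> index_family n I ->
  [/\ centrally_symmetric (DeltaI n I),
      combinatorial_sphere R 3 (DeltaI n I),
      vertex_set (DeltaI n I) (Vset n.+1)
    & cs_neighborly 2 n.+1 (DeltaI n I)].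
Proof.
move=> n10 fI; have n4 : (4 <= n)%N by apply: leq_trans n10.
have n0 : (0 < n)%N by apply: leq_trans n10.
have [DF goodF _] := Delta3_all R n4.
have [S stS SP] := BI_stack n10 fI.
have SF : S `<=` facets (Delta 3 n).
  by apply/fsubsetP => f /SP /(BI_part_shape n10 fI); exact: BI_shape_facet.
have SN : {in S, forall s, neg_face s \notin S}.
  move=> s /SP /(BI_part_shape n10 fI) sB; apply/negP => /SP /(BI_part_shape n10 fI).
  exact: BI_shape_antipodal.
have cov v : v \in Vset n -> exists2 s, s \in S & v \in s.
  by move=> /(BI_cover n10 fI)[s /SP sS vs]; exists s.
have SE : [fset s in BI_facets n I] = S.
  apply/fsetP => f; have -> : (f \in [fset s in BI_facets n I]) = (f \in BI_facets n I) by rewrite in_fset.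
  have [BIpart partBI] := BI_facetsP f n10 fI.
  by apply/idP/idP => [/BIpart/SP|/SP/partBI].
have good := cs_restack_sphere n0 goodF stS SF SN cov.
rewrite /DeltaI /BI SE DF (cs_replace_generated n0 goodF stS SF).
set F' := cs_restack _ _ _ in good *.
(* Singletons are antipode-free sets of size at most 2, so neighborliness already yields all the
   vertices. *)
have vertex v : v \in Vset n.+1 -> [fset v] \in generated F'.
  move=> vV; apply: (sphere_edges good); rewrite ?fsub1set ?cardfs1 //.
  apply/allP => w /fset1P ->; rewrite inE; move: vV; rewrite in_Vset; lia.
split.
- move=> s /generatedP[f fF sf]; apply/generatedP; exists (neg_face f).
    exact: (sphere_neg good).
  by rewrite neg_faceS.
- split; last exact: (sphere_PL good).
  apply: simplicial_complex_generated; apply/fset0Pn.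
  have /generatedP[f fF _] : [fset 1%R] \in generated F' by apply: vertex; rewrite in_Vset.
  by exists f.
- move=> v; apply/idP/idP => [/generatedP[f fF]|]; last exact: vertex.
  by rewrite fsub1set; apply: (fsubsetP (sphere_sub good fF)).
- exact: (sphere_edges good).
Qed.
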